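(* Let $\Lambda$ be an Artinian algebra and let $\Lambda^{o}$ be the opposite ring of $\Lambda$. Then $\Lambda$ satisfies the Gorenstein projective conjecture if and only if $\Lambda^{o}$ satisfies the Gorenstein projective conjecture.
   Context: An Artinian algebra (Artin algebra) is an algebra that is finitely generated as a module over a commutative Artinian ring. All modules are finitely generated left modules; left $\Lambda^{o}$-modules are identified with right $\Lambda$-modules. For an Artinian algebra $\Gamma$, a $\Gamma$-module $M$ is called Gorenstein projective if ${\rm Ext}_{\Gamma}^{i}(M,\Gamma)=0$ and ${\rm Ext}_{\Gamma^{o}}^{i}({\rm Tr}\,M,\Gamma)=0$ for all $i\geq 1$, where ${\rm Tr}\,M$ is the Auslander transpose of $M$ (a right $\Gamma$-module): if $P_1\to P_0\to M\to 0$ is a minimal projective presentation, then ${\rm Tr}\,M$ is the cokernel of ${\rm Hom}_\Gamma(P_0,\Gamma)\to{\rm Hom}_\Gamma(P_1,\Gamma)$. An Artinian algebra $\Gamma$ is said to satisfy the Gorenstein projective conjecture if for every Gorenstein projective $\Gamma$-module $M$: $M$ is projective if and only if ${\rm Ext}_{\Gamma}^{i}(M,M)=0$ for all $i\geq 1$. *)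

(* Defs.v *)
From HB Require Import structures.
From mathcomp Require Import all_boot all_algebra.
From mathcomp Require Import generic_quotient ring_quotient boolp.

Set Implicit Arguments.
Unset Strict Implicit.
Unset Printing Implicit Defensive.

Import GRing.Theory.
Local Open Scope ring_scope.
Local Open Scope quotient_scope.

(* Rings are [pzRingType]s, so that the zero ring is allowed.  Left R-modules
   are [lmodType R]; right R-modules are left modules over the opposite ring
   [R^c].  [R^o] is R as a left module over itself.

   Boolean predicates [{pred M}] stand for arbitrary subsets: [asbool] from
   [boolp] turns every [M -> Prop] into one. *)

Definition surjective (A B : Type) (f : A -> B) : Prop :=
  forall y, exists x, f x = y.

Definition finitely_generated (R : pzRingType) (M : lmodType R) : Prop :=
  exists (n : nat) (v : 'I_n -> M),
    forall x, exists c : 'I_n -> R, x = \sum_(i < n) c i *: v i.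

Definition artinian (k : comPzRingType) : Prop :=
  forall I : nat -> {pred k^o},
    (forall n, submod_closed (I n)) ->
    (forall n, {subset I n.+1 <= I n}) ->
    exists n, forall m, (n <= m)%N -> I m =i I n.

(* The structure map is a central ring morphism rather than an [algType]
   instance, because [algType] excludes the zero ring. *)
Definition artin_algebra (L : pzRingType) : Prop :=
  exists (k : comPzRingType) (phi : {rmorphism k -> L}),
    [/\ artinian k,
        forall a x, phi a * x = x * phi a
      & exists (n : nat) (v : 'I_n -> L),
          forall x, exists c : 'I_n -> k, x = \sum_(i < n) phi (c i) * v i].

Definition projective (R : pzRingType) (P : lmodType R) : Prop :=
  forall (M N : lmodType R) (g : {linear M -> N}) (f : {linear P -> N}),
    surjective g -> exists h : {linear P -> M}, forall x, g (h x) = f x.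

Record projective_resolution (R : pzRingType) (M : lmodType R) :=
  ProjectiveResolution {
    res_obj : nat -> lmodType R;
    res_diff : forall i, {linear res_obj i.+1 -> res_obj i};
    res_aug : {linear res_obj 0 -> M};
    res_projective : forall i, projective (res_obj i);
    res_aug_surj : surjective res_aug;
    res_aug_exact : forall x, res_aug x = 0 <-> exists y, res_diff 0 y = x;
    res_exact : forall i x,
      res_diff i x = 0 <-> exists y, res_diff i.+1 y = x }.

Section Ext.
Variables (R : pzRingType) (M N : lmodType R) (P : projective_resolution M).

Definition cocycle (i : nat) (f : {linear res_obj P i -> N}) : Prop :=
  forall x, f (res_diff P i x) = 0.

Definition coboundary (i : nat) : {linear res_obj P i -> N} -> Prop :=
  match i with
  | 0 => fun f => forall x, f x = 0
  | j.+1 => fun f =>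
      exists g : {linear res_obj P j -> N}, forall x, f x = g (res_diff P j x)
  end.

End Ext.

(* Ext^i(M, N) is the i-th cohomology of Hom(P, N) for a projective resolution
   P of M.  Every module has one (by free modules), and whether the cohomology
   vanishes does not depend on the choice. *)
Definition Ext_vanishes (R : pzRingType) (i : nat) (M N : lmodType R) : Prop :=
  forall (P : projective_resolution M) (f : {linear res_obj P i -> N}),
    cocycle f -> coboundary f.

(* Hom_R(P, R) is a right R-module by (f a)(x) = f(x) a. *)

Section Dual.
Variables (R : pzRingType) (P : lmodType R).

Definition dual : Type := {linear P -> R^o}.

HB.instance Definition _ := gen_eqMixin dual.
HB.instance Definition _ := gen_choiceMixin dual.

Definition dual_fun (f : dual) : P -> R^o := (f : {linear P -> R^o}).

Lemma dual_ext (f g : dual) : dual_fun f =1 dual_fun g -> f = g.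
Proof.
case: f => f [[fD] [fZ]]; case: g => g [[gD] [gZ]] /funext.
rewrite /dual_fun /= => fg; case: _ / fg gD gZ => gD gZ.
by rewrite (Prop_irrelevance fD gD) (Prop_irrelevance fZ gZ).
Qed.

Let dual_mk (f : P -> R^o) (fL : linear f) : dual :=
  HB.pack_for {linear P -> R^o} f (GRing.isLinear.Build R P R^o *:%R f fL).

Fact dual_zero_linear : linear (fun _ : P => 0 : R^o).
Proof. by move=> a x y; rewrite scaler0 addr0. Qed.

Fact dual_opp_linear (f : dual) : linear (fun x => - dual_fun f x).
Proof. by move=> a x y; rewrite /dual_fun linearP opprD scalerN. Qed.

Fact dual_add_linear (f g : dual) :
  linear (fun x => dual_fun f x + dual_fun g x).
Proof. by move=> a x y; rewrite /dual_fun !linearP scalerDr addrACA. Qed.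

Fact dual_scale_linear (a : R^c) (f : dual) :
  linear (fun x => dual_fun f x * (a : R) : R^o).
Proof.
by move=> b x y; rewrite /dual_fun linearP mulrDl /GRing.scale /= mulrA.
Qed.

Definition dual_zero : dual := dual_mk dual_zero_linear.
Definition dual_opp (f : dual) : dual := dual_mk (dual_opp_linear f).
Definition dual_add (f g : dual) : dual := dual_mk (dual_add_linear f g).
Definition dual_scale (a : R^c) (f : dual) : dual :=
  dual_mk (dual_scale_linear a f).

Fact dual_addA : associative dual_add.
Proof. by move=> f g h; apply: dual_ext => x; apply: addrA. Qed.
Fact dual_addC : commutative dual_add.
Proof. by move=> f g; apply: dual_ext => x; apply: addrC. Qed.
Fact dual_add0 : left_id dual_zero dual_add.
Proof. by move=> f; apply: dual_ext => x; apply: add0r. Qed.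
Fact dual_addN : left_inverse dual_zero dual_opp dual_add.
Proof. by move=> f; apply: dual_ext => x; apply: addNr. Qed.

HB.instance Definition _ :=
  GRing.isZmodule.Build dual dual_addA dual_addC dual_add0 dual_addN.

Fact dual_scaleA (a b : R^c) (f : dual) :
  dual_scale a (dual_scale b f) = dual_scale (a * b) f.
Proof. by apply: dual_ext => x; rewrite /dual_fun /= -mulrA. Qed.
Fact dual_scale1 : left_id 1 dual_scale.
Proof. by move=> f; apply: dual_ext => x; apply: mulr1. Qed.
Fact dual_scaleDr : right_distributive dual_scale +%R.
Proof. by move=> a f g; apply: dual_ext => x; apply: mulrDl. Qed.
Fact dual_scaleDl (f : dual) : {morph dual_scale^~ f : a b / a + b}.
Proof. by move=> a b; apply: dual_ext => x; apply: mulrDr. Qed.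

HB.instance Definition _ := GRing.Zmodule_isLmodule.Build R^c dual
  dual_scaleA dual_scale1 dual_scaleDr dual_scaleDl.

End Dual.

Section DualMap.
Variables (R : pzRingType) (P Q : lmodType R) (p : {linear P -> Q}).

Definition dual_map (f : dual Q) : dual P :=
  (f : {linear Q -> R^o}) \o p.

Fact dual_map_linear : linear dual_map.
Proof. by move=> a f g; apply: dual_ext. Qed.

HB.instance Definition _ :=
  GRing.isLinear.Build R^c (dual Q) (dual P) *:%R dual_map dual_map_linear.

End DualMap.

Section Cokernel.
Variables (R : pzRingType) (U V : lmodType R) (f : {linear U -> V}).

Definition image_pred : {pred V} := fun y => `[< exists x, f x = y >].

Fact image_pred_zmod_closed : zmod_closed image_pred.
Proof.
split=> [|y z /asboolP[u <-] /asboolP[v <-]]; apply/asboolP.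
  by exists 0; rewrite linear0.
by exists (u - v); rewrite linearB.
Qed.

HB.instance Definition _ :=
  GRing.isZmodClosed.Build V image_pred image_pred_zmod_closed.

Definition coker : Type := {ideal_quot image_pred}.

HB.instance Definition _ := GRing.Zmodule.on coker.
HB.instance Definition _ := EqQuotient.on coker.

Definition coker_proj (y : V) : coker := \pi_{ideal_quot image_pred} y.

Definition coker_scale (a : R) (q : coker) : coker := coker_proj (a *: repr q).

Lemma coker_projP y z : coker_proj y = coker_proj z <-> exists x, f x = y - z.
Proof.
split=> [/eqP|fx]; first by rewrite -Quotient.idealrBE => /asboolP.
by apply/eqP; rewrite -Quotient.idealrBE; apply/asboolP.
Qed.

Lemma coker_proj_surj : surjective coker_proj.
Proof. by move=> q; exists (repr q); apply: reprK. Qed.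

Lemma coker_projD y z : coker_proj (y + z) = coker_proj y + coker_proj z.
Proof. by rewrite /coker_proj !piE. Qed.

Lemma coker_projZ a y : coker_proj (a *: y) = coker_scale a (coker_proj y).
Proof.
apply/coker_projP; have /coker_projP[x fx] :
  coker_proj y = coker_proj (repr (coker_proj y)) by rewrite {2}/coker_proj reprK.
by exists (a *: x); rewrite linearZ fx -scalerBr.
Qed.

Fact coker_scaleA a b q : coker_scale a (coker_scale b q) = coker_scale (a * b) q.
Proof. by have [y <-] := coker_proj_surj q; rewrite -!coker_projZ scalerA. Qed.
Fact coker_scale1 : left_id 1 coker_scale.
Proof.
by move=> q; have [y <-] := coker_proj_surj q; rewrite -coker_projZ scale1r.
Qed.
Fact coker_scaleDr : right_distributive coker_scale +%R.
Proof.
move=> a q r; have [y <-] := coker_proj_surj q; have [z <-] := coker_proj_surj r.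
by rewrite -coker_projD -!coker_projZ -coker_projD scalerDr.
Qed.
Fact coker_scaleDl q : {morph coker_scale^~ q : a b / a + b}.
Proof.
move=> a b; have [y <-] := coker_proj_surj q.
by rewrite -!coker_projZ -coker_projD scalerDl.
Qed.

HB.instance Definition _ := GRing.Zmodule_isLmodule.Build R coker
  coker_scaleA coker_scale1 coker_scaleDr coker_scaleDl.

Fact coker_proj_linear : linear coker_proj.
Proof. by move=> a y z; rewrite coker_projD coker_projZ. Qed.

HB.instance Definition _ :=
  GRing.isLinear.Build R V coker *:%R coker_proj coker_proj_linear.

End Cokernel.

Definition superfluous_kernel (R : pzRingType) (U V : lmodType R)
    (f : {linear U -> V}) : Prop :=
  forall S : {pred U}, submod_closed S ->
    (forall x, exists2 y, y \in S & f (x - y) = 0) -> forall x, x \in S.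

(* [p0] is a projective cover of M and [p1] induces a projective cover of the
   kernel of [p0]. *)
Record minimal_projective_presentation (R : pzRingType) (M : lmodType R) :=
  MinimalProjectivePresentation {
    pres1 : lmodType R;
    pres0 : lmodType R;
    pres_map : {linear pres1 -> pres0};
    pres_aug : {linear pres0 -> M};
    pres1_fg : finitely_generated pres1;
    pres0_fg : finitely_generated pres0;
    pres1_projective : projective pres1;
    pres0_projective : projective pres0;
    pres_aug_surj : surjective pres_aug;
    pres_exact : forall x, pres_aug x = 0 <-> exists y, pres_map y = x;
    pres_aug_minimal : superfluous_kernel pres_aug;
    pres_map_minimal : superfluous_kernel pres_map }.

Definition Tr (R : pzRingType) (M : lmodType R)
    (p : minimal_projective_presentation M) : lmodType R^c :=
  coker (dual_map (pres_map p)).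

(* [Tr p] depends on the minimal presentation [p] only up to isomorphism, and
   finitely generated modules over Artin algebras have such presentations. *)
Definition Gorenstein_projective (R : pzRingType) (M : lmodType R) : Prop :=
  (forall i, (1 <= i)%N -> Ext_vanishes i M R^o) /\
  (forall (p : minimal_projective_presentation M) i,
     (1 <= i)%N -> Ext_vanishes i (Tr p) (R^c)^o).

Definition Gorenstein_projective_conjecture (R : pzRingType) : Prop :=
  forall M : lmodType R, finitely_generated M -> Gorenstein_projective M ->
    (projective M <-> forall i, (1 <= i)%N -> Ext_vanishes i M M).

(* Main.v *)
Require Import Defs.
From HB Require Import structures.
From mathcomp Require Import all_boot all_algebra.
From mathcomp Require Import boolp.

Set Implicit Arguments.
Unset Strict Implicit.
Unset Printing Implicit Defensive.

Import GRing.Theory.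
Local Open Scope ring_scope.

(** Write M' for the dual Hom(M, L).  Splicing a projective resolution of M'
    with the dual of a minimal presentation of M resolves Tr M, and reading off
    its cohomology shows that M is Gorenstein projective if and only if M is
    reflexive and Ext^i(M, L) = 0 = Ext^i(M', L^o) for all i >= 1.  This
    description is symmetric, so M' is again Gorenstein projective.  Dualizing a
    projective resolution Q of M' gives an exact sequence
    0 -> M -> Q_0' -> Q_1' -> ..., and dimension shifting along it turns
    Ext^i(M, M) = 0 into Ext^i(M', M') = 0.  The conjecture for L^o then makes
    M' projective, and hence M.  Finiteness of L over an Artinian ring enters
    only through the existence of minimal presentations and of resolutions by
    finitely generated projectives. *)

(** Flipping the multiplication twice returns the original operation by conversion, so the two
    structures differ only in the proofs of the ring laws. *)
Lemma converseK (R : pzRingType) : (R^c)^c = R :> pzRingType.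
Proof.
case: R => [T [c1 c2 c3 c4 c5 c6 c7 c8 c9 [o m a1 a2 a3 a4 a5 a6 a7]]].
congr (GRing.PzRing.Pack (GRing.PzRing.Class _ _)).
by congr (GRing.Nmodule_isPzSemiRing.Axioms_ _ _ _ _ _ _ _);
  apply: Prop_irrelevance.
Qed.

(** * Submodules and linear maps *)

Section Submodule.
Variables (R : pzRingType) (V : lmodType R) (S : {pred V}).
Hypothesis hS : submod_closed S.

(* The vacuous dependency on [hS] makes closure inferable from the predicate. *)
Definition submod_pred : {pred V} := let _ := hS in S.
HB.instance Definition _ := GRing.isSubmodClosed.Build R V submod_pred hS.
Definition submod := {x : V | x \in submod_pred}.
HB.instance Definition _ := SubChoice.on submod.
HB.instance Definition _ := [SubChoice_isSubLmodule of submod by <:].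

Definition submod_val : {linear submod -> V} := val.

Lemma submod_valP (x : submod) : submod_val x \in S.
Proof. exact: (valP x). Qed.

Lemma submod_val_inj : injective submod_val.
Proof. exact: val_inj. Qed.

Lemma submod_val_ex x : x \in S -> exists y, submod_val y = x.
Proof. by move=> xS; exists (exist _ x xS). Qed.

End Submodule.

Arguments submod_val {R V S hS}.
Arguments submod_val_inj {R V S hS}.

Section LinearMaps.
Variable R : pzRingType.
Implicit Types U V W X A P Q M N : lmodType R.

Definition mk_linear U V (f : U -> V) (fL : linear f) : {linear U -> V} :=
  HB.pack_for {linear U -> V} f (GRing.isLinear.Build R U V *:%R f fL).

Lemma linear_of_graph U V (r : U -> V -> Prop) :
    (forall x, exists y, r x y) ->
    (forall x y z, r x y -> r x z -> y = z) ->
    (forall a x x' y y', r x y -> r x' y' -> r (a *: x + x') (a *: y + y')) ->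
  exists h : {linear U -> V}, forall x, r x (h x).
Proof.
move=> /choice[h hr] runiq rlin.
have hL : linear h by move=> a x y; apply: runiq (hr _) _; apply: rlin.
by exists (mk_linear hL).
Qed.

Lemma corestriction U V (S : {pred V}) (hS : submod_closed S)
    (f : {linear U -> V}) :
    (forall x, f x \in S) ->
  exists f' : {linear U -> submod hS}, forall x, submod_val (f' x) = f x.
Proof.
move=> fS; apply: (linear_of_graph (r := fun x y => submod_val y = f x)).
- by move=> x; apply: submod_val_ex.
- by move=> x y z yx zx; apply: submod_val_inj; apply: etrans yx (esym zx).
- by move=> a x x' y y' yx yx'; rewrite !linearP; congr (_ *: _ + _).
Qed.

Lemma ker_submod_closed U V (f : {linear U -> V}) :
  submod_closed [pred x | f x == 0].
Proof.
split=> [|a x y]; rewrite !inE ?linear0 // => /eqP fx /eqP fy.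
by rewrite linearP fx fy scaler0 addr0.
Qed.

Definition ker U V (f : {linear U -> V}) : lmodType R :=
  submod (ker_submod_closed f).

Definition ker_val U V (f : {linear U -> V}) : {linear ker f -> U} :=
  submod_val.

Arguments ker_val {U V f}.

Lemma ker_valP U V (f : {linear U -> V}) (x : ker f) : f (ker_val x) = 0.
Proof. exact/eqP/(submod_valP x). Qed.

Lemma ker_val_inj U V (f : {linear U -> V}) : injective (@ker_val _ _ f).
Proof. exact: submod_val_inj. Qed.

Lemma ker_val_ex U V (f : {linear U -> V}) x :
  f x = 0 -> exists y : ker f, ker_val y = x.
Proof. by move/eqP => fx; apply: submod_val_ex. Qed.

Lemma image_submod_closed U V (f : {linear U -> V}) :
  submod_closed (image_pred f).
Proof.
split=> [|a y z /asboolP[u <-] /asboolP[v <-]]; apply/asboolP.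
  by exists 0; rewrite linear0.
by exists (a *: u + v); rewrite linearP.
Qed.

(** Here [g] need not be onto: both maps are corestricted to the image of [g], where projectivity of
    [Q] applies. *)
Lemma projective_lift Q X A (g : {linear X -> A}) (f : {linear Q -> A}) :
    projective Q -> (forall q, exists x, g x = f q) ->
  exists h : {linear Q -> X}, forall q, g (h q) = f q.
Proof.
move=> Qproj fg; have S := image_submod_closed g.
have [q|f' f'E] := @corestriction _ _ _ S f; first exact/asboolP.
have [x|g' g'E] := @corestriction _ _ _ S g; first by apply/asboolP; exists x.
have [y|h hE] := Qproj _ _ g' f'.
  have /asboolP[x xy] := submod_valP y.
  by exists x; apply: (@submod_val_inj _ _ _ S); rewrite g'E.
by exists h => q; rewrite -g'E hE f'E.
Qed.

Lemma factor_through U V W (p : {linear U -> V}) (f : {linear U -> W}) :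
    surjective p -> (forall x, p x = 0 -> f x = 0) ->
  exists g : {linear V -> W}, forall x, g (p x) = f x.
Proof.
move=> psurj pf.
have [||a x x' y y' [u <- <-] [u' <- <-]|g gE] :=
    @linear_of_graph V W (fun y z => exists2 x, p x = y & f x = z).
- by move=> y; have [x px] := psurj y; exists (f x); exists x.
- move=> x y z [u ux <-] [v vx <-]; apply/subr0_eq; rewrite -linearB pf //.
  by rewrite linearB ux vx subrr.
- by exists (a *: u + u'); rewrite linearP.
- exists g => x; have [u ux <-] := gE (p x); apply/subr0_eq.
  by rewrite -linearB pf // linearB ux subrr.
Qed.

(** Preimages under [j] are unique, so choosing them pointwise is automatically linear. The usual
    [j] is the inclusion of a kernel. *)
Lemma coinduced_injective U V W (j : {linear U -> V}) (f : {linear W -> V}) :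
    injective j -> (forall x, exists y, j y = f x) ->
  exists g : {linear W -> U}, forall x, j (g x) = f x.
Proof.
move=> jinj fj; apply: (@linear_of_graph _ _ (fun x y => j y = f x)) => //.
- by move=> x y z yx zx; apply: jinj; apply: etrans yx (esym zx).
- by move=> a x x' y y' yx yx'; rewrite !linearP; congr (_ *: _ + _).
Qed.

End LinearMaps.

Arguments ker_val {R U V f}.
(** * Projective modules and duality *)

Section Projective.
Variable R : pzRingType.
Implicit Types U V W X A P Q M N : lmodType R.

Definition free_module (n : nat) : lmodType R := {ffun 'I_n -> R^o}.

Lemma combination_linear n M (v : 'I_n -> M) :
  linear (fun c : free_module n => \sum_(i < n) (c i : R) *: v i).
Proof.
move=> a x y; rewrite scaler_sumr -big_split; apply: eq_bigr => i _.
by rewrite !ffunE scalerDl scalerA.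
Qed.

Definition combination n M (v : 'I_n -> M) : {linear free_module n -> M} :=
  mk_linear (combination_linear v).

Lemma coordinate_linear n i :
  linear (fun c : free_module n => c i : R^o).
Proof. by move=> a x y; rewrite !ffunE. Qed.

Definition coordinate n i : {linear free_module n -> R^o} :=
  mk_linear (@coordinate_linear n i).

Lemma combination_unit n (c : free_module n) :
  combination (fun i => [ffun j => (j == i)%:R] : free_module n) c = c.
Proof.
apply/ffunP => j; rewrite sum_ffunE (bigD1 j) //= !ffunE eqxx.
rewrite big1 => [|i /negPf].
  by rewrite addr0 [_ *: _]mulr1.
by rewrite !ffunE eq_sym => ->; rewrite [_ *: _]mulr0.
Qed.

Lemma finitely_generatedP M :
  finitely_generated M <->
  exists n (p : {linear free_module n -> M}), surjective p.
Proof.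
split=> [[n [v vM]]|[n [p psurj]]].
  exists n, (combination v) => y; have [c ->] := vM y.
  exists [ffun i => c i]; rewrite /combination /=.
  by apply: eq_bigr => i _; rewrite ffunE.
exists n, (fun i => p [ffun j => (j == i)%:R]) => y.
have [c <-] := psurj y; exists c.
rewrite -[in LHS](combination_unit c) linear_sum.
by apply: eq_bigr => i _; rewrite linearZ.
Qed.

Lemma finitely_generated_image M N (p : {linear M -> N}) :
  surjective p -> finitely_generated M -> finitely_generated N.
Proof.
move=> psurj /finitely_generatedP[n [q qsurj]].
apply/finitely_generatedP; exists n, (p \o q) => y.
have [x <-] := psurj y; have [z <-] := qsurj x; by exists z.
Qed.

Lemma free_module_projective n : projective (free_module n).
Proof.
move=> M N g f gsurj.
have [w wE] := choice (fun i => gsurj (f [ffun j => (j == i)%:R])).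
exists (combination w) => c; rewrite -[in RHS](combination_unit c) !linear_sum.
by apply: eq_bigr => i _; rewrite !linearZ wE.
Qed.

Lemma free_module_fg n : finitely_generated (free_module n).
Proof. by apply/finitely_generatedP; exists n, idfun => x; exists x. Qed.

Lemma projective_retract P Q (r : {linear Q -> P}) (s : {linear P -> Q}) :
  (forall x, r (s x) = x) -> projective Q -> projective P.
Proof.
move=> rs Qproj M N g f gsurj; have [h hE] := Qproj _ _ g (f \o r) gsurj.
by exists (h \o s) => x; rewrite /= hE /= rs.
Qed.

Lemma projective_section P Q (r : {linear Q -> P}) :
  surjective r -> projective P ->
  exists s : {linear P -> Q}, forall x, r (s x) = x.
Proof. by move=> rsurj Pproj; apply: (Pproj _ _ r idfun). Qed.

Definition has_dual_basis P : Prop :=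
  exists n (v : 'I_n -> P) (f : 'I_n -> dual P),
    forall x, x = \sum_(i < n) (dual_fun (f i) x : R) *: v i.

(** A dual basis amounts to a splitting of a surjection from a free module: the functionals are the
    coordinates of the section. *)
Lemma dual_basisP P :
  has_dual_basis P <-> finitely_generated P /\ projective P.
Proof.
split=> [[n [v [f vf]]]|[/finitely_generatedP[n [p psurj]] Pproj]]; last first.
  have [s ps] := projective_section psurj Pproj.
  exists n, (fun i => p [ffun j => (j == i)%:R]), (fun i => coordinate i \o s).
  move=> x; rewrite -[LHS]ps -[s x in LHS](combination_unit (s x)) linear_sum.
  by apply: eq_bigr => i _; rewrite linearZ.
split; first by exists n, v => x; exists (fun i => dual_fun (f i) x).
have sL : linear (fun x => [ffun i => dual_fun (f i) x] : free_module n).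
  by move=> a x y; apply/ffunP => i; rewrite !ffunE /dual_fun linearP.
apply: (@projective_retract _ _ (combination v) (mk_linear sL)) => [x|].
  rewrite [RHS]vf; apply: eq_bigr => i _; rewrite /=.
  by rewrite ffunE.
exact: free_module_projective.
Qed.

Lemma dual_fun_sum M n (f : 'I_n -> dual M) x :
  dual_fun (\sum_(i < n) f i) x = \sum_(i < n) dual_fun (f i) x.
Proof. exact: (big_morph (fun f : dual M => dual_fun f x)). Qed.

Lemma eval_linear M (x : M) :
  linear (fun f : dual M => dual_fun f x : (R^c)^o).
Proof. by []. Qed.

Definition eval M (x : M) : dual (dual M) := mk_linear (eval_linear x).

Definition separated M : Prop :=
  forall x : M, (forall f : dual M, dual_fun f x = 0) -> x = 0.

Definition reflexive_module M : Prop :=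
  separated M /\ forall u : dual (dual M), exists x, u = eval x.

Lemma separated_eq M (x y : M) : separated M ->
  (forall f : dual M, dual_fun f x = dual_fun f y) -> x = y.
Proof.
move=> Msep fxy; apply/subr0_eq/Msep => f.
by rewrite /dual_fun linearB; apply/eqP; rewrite subr_eq0; apply/eqP/fxy.
Qed.

Lemma dual_basis_separated P : has_dual_basis P -> separated P.
Proof.
move=> [n [v [f vf]]] x fx0; rewrite (vf x) big1 // => i _.
by rewrite fx0 scale0r.
Qed.

(** Apply [u] to the expansion of [x]. Consequently the [f i], with the functionals [eval (v i)],
    form a dual basis of [dual P]. *)
Lemma dual_basis_expand P n (v : 'I_n -> P) (f : 'I_n -> dual P) (u : dual P) :
    (forall x, x = \sum_(i < n) (dual_fun (f i) x : R) *: v i) ->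
  u = \sum_(i < n) (dual_fun u (v i) : R^c) *: f i.
Proof.
move=> vf; apply: dual_ext => x; rewrite dual_fun_sum {1}(vf x).
by rewrite /dual_fun linear_sum; apply: eq_bigr => i _; rewrite linearZ.
Qed.

Lemma dual_basis_reflexive P : has_dual_basis P -> reflexive_module P.
Proof.
move=> Pdb; split; first exact: dual_basis_separated.
have [n [v [f vf]]] := Pdb => u.
(* The [f i] generate the dual, so [u] is determined by its values on them, and this vector realizes
   those values. *)
exists (\sum_(i < n) (dual_fun u (f i) : R) *: v i); apply: dual_ext => g.
rewrite [in LHS](dual_basis_expand g vf) /dual_fun linear_sum.
change (\sum_i u ((dual_fun g (v i) : R^c) *: f i) =
  (g : {linear P -> R^o}) (\sum_(i < n) (dual_fun u (f i) : R) *: v i)).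
rewrite linear_sum; apply: eq_bigr => i _.
by rewrite !linearZ.
Qed.

End Projective.

Lemma dual_basis_dual (R : pzRingType) (P : lmodType R) :
  has_dual_basis P -> has_dual_basis (dual P).
Proof.
move=> [n [v [f vf]]]; exists n, f, (fun i => eval (v i)) => u.
exact: dual_basis_expand.
Qed.

Lemma reflexive_dual (R : pzRingType) (M : lmodType R) :
  reflexive_module M -> reflexive_module (dual M).
Proof.
move=> [Msep Mrefl]; split=> [n n0|U].
  by apply: dual_ext => x; apply: (n0 (eval x)).
(* Composing [U] with [eval] gives the functional on [M] that represents [U], since every element of
   the bidual is some [eval x]. *)
have nL : linear (fun x : M => dual_fun U (eval x) : R^o).
  move=> a x y; have -> : eval (a *: x + y) = (a : (R^c)^c) *: eval x + eval y.
    by apply: dual_ext => f; apply: (linearP (f : {linear M -> R^o})).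
  by rewrite /dual_fun linearP.
exists (mk_linear nL : dual M); apply: dual_ext => u.
by have [x ->] := Mrefl u.
Qed.

(** The coordinate functionals of a dual basis of [dual M] lie in the bidual, hence come from
    elements of [M]. These elements, with the generators [f i] as functionals, form a dual basis of
    [M]. *)
Lemma projective_of_dual (R : pzRingType) (M : lmodType R) :
    reflexive_module M -> finitely_generated (dual M) -> projective (dual M) ->
  projective M.
Proof.
move=> [Msep Mrefl] Nfg Nproj.
have /dual_basisP[n [f [u fu]]] := conj Nfg Nproj.
have [v vE] := choice (fun i => Mrefl (u i)).
suff /dual_basisP[] : has_dual_basis M by [].
exists n, v, f => x; apply: separated_eq => // g.
rewrite [in LHS](fu g) dual_fun_sum /dual_fun linear_sum; apply: eq_bigr => i _.
by rewrite linearZ vE.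
Qed.

(** * Artinian commutative rings are Noetherian *)

Section Span.
Variables (R : pzRingType) (V : lmodType R).
Implicit Types (s t : seq V) (x y : V).

(** Peeling off one generator at a time opens linear spans to induction on the list of
    generators. *)
Fixpoint span s x : Prop :=
  if s is v :: t then exists c : R, span t (x - c *: v) else x = 0.

Lemma span_linear s a x y : span s x -> span s y -> span s (a *: x + y).
Proof.
elim: s x y => [x y -> ->|v s IHs x y [c cx] [d dy]] /=.
  by rewrite scaler0 addr0.
exists (a * c + d); rewrite scalerDl -scalerA opprD addrACA -scalerBr.
exact: IHs.
Qed.

Lemma span0 s : span s 0.
Proof. by elim: s => //= v s IHs; exists 0; rewrite scale0r subr0. Qed.

Lemma spanD s x y : span s x -> span s y -> span s (x + y).
Proof. by move=> sx sy; rewrite -[x]scale1r; apply: span_linear. Qed.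

Lemma spanZ s a x : span s x -> span s (a *: x).
Proof. by move=> sx; rewrite -[_ *: x]addr0; apply/span_linear/span0. Qed.

Lemma spanN s x : span s x -> span s (- x).
Proof. by rewrite -scaleN1r; apply: spanZ. Qed.

Lemma span_head v s : span (v :: s) v.
Proof. by exists 1; rewrite scale1r subrr; apply: span0. Qed.

Lemma span_cons v s x : span s x -> span (v :: s) x.
Proof. by exists 0; rewrite scale0r subr0. Qed.

Lemma span_mem s v : v \in s -> span s v.
Proof.
elim: s => // u s IHs; rewrite inE => /orP[/eqP ->|/IHs sv].
  exact: span_head.
exact: span_cons.
Qed.

Lemma span_bigsum n s (v : 'I_n -> V) :
  (forall i, span s (v i)) -> span s (\sum_i v i).
Proof.
by move=> sv; apply: big_ind => //; [exact: span0 | exact: spanD].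
Qed.

Lemma span_cat s t x :
  span (s ++ t) x <-> exists y z, [/\ span s y, span t z & x = y + z].
Proof.
elim: s x => [|v s IHs] x /=.
  split=> [tx|[y [z [-> tz ->]]]]; last by rewrite add0r.
  by exists 0, x; rewrite add0r.
split=> [[c /IHs[y [z [sy tz xyz]]]]|[y [z [[c sy] tz ->]]]].
  exists (y + c *: v), z; split=> //; first by exists c; rewrite addrK.
  by rewrite addrAC -xyz subrK.
exists c; apply/IHs; exists (y - c *: v), z; split=> //.
by rewrite addrAC.
Qed.

Lemma span_sub (S : {pred V}) s x : submod_closed S ->
  (forall v, v \in s -> v \in S) -> span s x -> x \in S.
Proof.
move=> [S0 SL]; elim: s x => [x _ -> //|v s IHs x sS [c cx]].
rewrite -(subrK (c *: v) x) addrC; apply: SL.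
  by apply: sS; rewrite mem_head.
by apply: IHs cx => u us; apply: sS; rewrite inE us orbT.
Qed.

Definition spans s (S : {pred V}) : Prop :=
  (forall v, v \in s -> v \in S) /\ forall x, x \in S -> span s x.

Lemma finitely_generated_span :
  finitely_generated V <-> exists s, forall x, span s x.
Proof.
split=> [[n [v vV]]|[s sV]].
  exists [seq v i | i <- enum 'I_n] => x; have [c ->] := vV x.
  apply: span_bigsum => i; apply/spanZ/span_mem/map_f.
  by rewrite mem_enum.
exists (size s), (fun i => s`_i) => x; elim: s x {sV}(sV x) => [|v s IHs] x /=.
  by move=> ->; exists (fun=> 0); rewrite big_ord0.
move=> [c /IHs[d xd]].
exists (fun i => if unlift ord0 i is Some j then d j else c).
rewrite big_ord_recl unlift_none /= -[x](subrK (c *: v)) xd addrC.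
by congr (_ + _); apply: eq_bigr => i _; rewrite liftK.
Qed.

End Span.

Definition chain_stable (V : Type) (I : nat -> {pred V}) : Prop :=
  exists n, forall m, (n <= m)%N -> I m =i I n.

Section Artinian.
Variable k : comPzRingType.
Hypothesis kart : artinian k.

Section FiniteModule.
Variable V : lmodType k.

Lemma dec_subset (I : nat -> {pred V}) n m :
  (forall n, {subset I n.+1 <= I n}) -> (n <= m)%N -> {subset I m <= I n}.
Proof.
move=> Idec /subnKC <-; elim: (m - n)%N => [|d IHd] x; rewrite ?addn0 //.
by rewrite addnS => /Idec/IHd.
Qed.

(* The coefficients of [v] in the elements of a submodule lying in
   [k v + span s] form an ideal; a decreasing chain of submodules is controlled
   by its trace on [span s] and the chain of these ideals. *)
Definition lead_ideal (s : seq V) (v : V) (S : {pred V}) : {pred k^o} :=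
  fun c => `[< exists2 u, span s u & (c : k) *: v + u \in S >].

Lemma lead_ideal_closed s v S : submod_closed S ->
  submod_closed (lead_ideal s v S).
Proof.
move=> [S0 SL]; split=> [|a x y /asboolP[u su uS] /asboolP[w sw wS]].
  by apply/asboolP; exists 0; [exact: span0 | rewrite scale0r addr0].
apply/asboolP; exists (a *: u + w); first exact: span_linear.
have := SL a _ _ uS wS.
by rewrite scalerDr addrACA scalerA -scalerDl.
Qed.

Lemma artinian_chain (I : nat -> {pred V}) :
    finitely_generated V -> (forall n, submod_closed (I n)) ->
    (forall n, {subset I n.+1 <= I n}) ->
  chain_stable I.
Proof.
move=> /finitely_generated_span[s sV] Isub Idec.
suff [n nI] : exists n, forall m, (n <= m)%N ->
    forall x, span s x -> x \in I n -> x \in I m.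
  exists n => m nm x; apply/idP/idP => [|xI]; first exact: dec_subset.
  exact: nI.
elim: s {sV} => [|v s [n1 IHs]].
  by exists 0%N => m _ x -> _; have [] := Isub m.
have [||n2 n2J] := kart (I := fun n => lead_ideal s v (I n)).
- by move=> n; apply: lead_ideal_closed.
- by move=> n c /asboolP[u su uI]; apply/asboolP; exists u => //; apply: Idec.
exists (maxn n1 n2) => m; rewrite geq_max => /andP[n1m n2m] x [c sc] xI.
have : (c : k^o) \in lead_ideal s v (I m).
  rewrite n2J //; apply/asboolP; exists (x - c *: v); rewrite // addrC subrK.
  by apply: (dec_subset Idec) xI; apply: leq_maxr.
(* Subtracting from [x] an element of [I m] with the same coefficient [c] at [v] leaves an element
   of [span s], to which [IHs] applies. *)
move=> /asboolP[u su uI]; rewrite -(subrK (c *: v + u) x).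
have [_ ImL] := Isub m; rewrite -[_ - _]scale1r; apply: ImL => //.
apply: (IHs m n1m).
  by rewrite opprD addrA; apply: spanD => //; apply: spanN.
have [_ In1L] := Isub n1; rewrite addrC -scaleN1r; apply: In1L.
  exact: (dec_subset Idec n1m).
by apply: (dec_subset Idec) xI; apply: leq_maxl.
Qed.

(** Without a minimal member, choosing a strictly smaller member again and again would give a
    descending chain that never stabilizes. *)
Lemma minimal_submodule (F : {pred V} -> Prop) (S0 : {pred V}) :
    finitely_generated V -> F S0 -> (forall S, F S -> submod_closed S) ->
  exists S, F S /\ forall T, F T -> {subset T <= S} -> {subset S <= T}.
Proof.
move=> Vfg FS0 Fsub; apply: contrapT => nmin.
have next (S : {S | F S}) :
    exists T : {T | F T}, {subset sval T <= sval S} /\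
      ~ {subset sval S <= sval T}.
  apply: contrapT => nT; apply: nmin; exists (sval S); split.
    exact: (svalP S).
  move=> T FT TS; apply: contrapT => nST; apply: nT.
  by exists (exist _ T FT).
have [g gE] := choice next.
pose I n := sval (iter n g (exist _ S0 FS0)).
have [|n|n nI] := @artinian_chain I Vfg.
- by move=> n; apply: Fsub; apply: svalP.
- by have [] := gE (iter n g (exist _ S0 FS0)).
- have [_] := gE (iter n g (exist _ S0 FS0)); apply => x.
  by rewrite -[X in X -> _]/(x \in I n = true) -(nI n.+1) ?leqnSn.
Qed.

End FiniteModule.

Lemma regular_fg : finitely_generated k^o.
Proof.
apply/finitely_generated_span; exists [:: 1] => x; exists x.
by rewrite [_ *: _]mulr1 subrr.
Qed.

(** * Excluding a minimal non-finitely generated ideal *)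

Section MinimalNonFinitelyGenerated.
Variable I : {pred k^o}.
Hypothesis Isub : submod_closed I.
Hypothesis Infg : ~ exists t, spans t I.
Hypothesis Imin : forall T : {pred k^o}, submod_closed T -> {subset T <= I} ->
  {subset I <= T} \/ exists t, spans t T.

Lemma scale_linear x : linear (fun z : k^o => x * z : k^o).
Proof. by move=> a u v; rewrite mulrDr; congr (_ + _); apply: mulrCA. Qed.

(** Let [T] be the image of [I] under multiplication by [x] and [K] its kernel. If both were proper
    in [I], both would be finitely generated by minimality, and then so would their extension
    [I]. *)
Lemma zero_or_surjective x :
  (forall i, i \in I -> x * i = 0) \/
  (forall i, i \in I -> exists2 j, j \in I & i = x * j).
Proof.
have [I0 IL] := Isub; pose f := mk_linear (scale_linear x).
pose T : {pred k^o} := fun z => `[< exists2 j, j \in I & z = x * j >].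
have [|z|IT|[t [tT Tt]]] := @Imin T.
- split=> [|a u v /asboolP[i iI ->] /asboolP[j jI ->]]; apply/asboolP.
    by exists 0; rewrite ?mulr0.
  by exists (a *: i + j); [exact: IL | exact: esym (scale_linear x a i j)].
- by move=> /asboolP[j jI ->]; rewrite -[_ * _]addr0; apply: IL.
- by right=> i /IT/asboolP.
pose K : {pred k^o} := [pred z in I | x * z == 0].
have [|z|IK|[s [sK Ks]]] := @Imin K.
- split=> [|a u v]; rewrite !inE ?I0 ?mulr0 ?eqxx // => /andP[uI /eqP u0].
  move=> /andP[vI /eqP v0]; rewrite IL //=; apply/eqP.
  by rewrite [LHS](scale_linear x a u v) u0 v0 scaler0 addr0.
- by rewrite inE => /andP[].
- by left=> i /IK; rewrite inE => /andP[_ /eqP].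
(* [h] picks a preimage in [I] of each element of [T]; outside [T] the value 0 is a dummy. *)
have /choice[h hE] (v : k^o) : exists j : k^o, v \in T -> j \in I /\ v = x * j.
  have [/asboolP[j jI ->]|vT] := boolP (v \in T); first by exists j.
  by exists 0.
have htI v : v \in [seq h v | v <- t] -> v \in I.
  by move=> /mapP[u /tT/hE[]] uI _ ->.
have tlift z : span t z ->
    exists2 y : k^o, span [seq h v | v <- t] y & z = x * y.
  elim: t tT z {Tt htI} => [|v t IHt] tT z /=.
    by exists 0; rewrite ?mulr0.
  move=> [c cz]; have [u ut|y ty zy] := IHt _ _ cz.
    by apply: tT; rewrite inE ut orbT.
  exists (c *: h v + y); first by exists c; rewrite addrAC subrr add0r.
  have [_ vE] := hE v (tT v (mem_head _ _)).
  by rewrite [RHS](scale_linear x c (h v) y) -zy -vE addrC subrK.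
(* Lifts of generators of [T] together with generators of [K] span [I]. *)
case: Infg; exists ([seq h v | v <- t] ++ s); split=> [v|i iI].
  by rewrite mem_cat => /orP[/htI//|/sK/andP[]].
have [|y ty xy] := tlift (x * i); first by apply/Tt/asboolP; exists i.
apply/span_cat; exists y, (i - y); split; rewrite ?(addrC y) ?subrK //.
apply: Ks; rewrite inE mulrBr xy subrr eqxx andbT.
rewrite addrC -scaleN1r; apply: IL => //.
exact: span_sub htI ty.
Qed.

(** The chain of ideals generated by the powers of [x] stabilizes, so [x ^+ n = x ^+ n.+1 * w] for
    some [w]. If [x] maps [I] onto itself, every element of [I] is a multiple of [x ^+ n], and [w]
    undoes [x] on it. *)
Lemma zero_or_invertible x :
  (forall i, i \in I -> x * i = 0) \/
  exists y, forall i, i \in I -> y * x * i = i.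
Proof.
have [x0|xI] := zero_or_surjective x; [by left | right].
pose J n : {pred k^o} := fun z => `[< exists w, z = x ^+ n * w >].
have [n||n nJ] := kart (I := J).
- split=> [|a u v /asboolP[i ->] /asboolP[j ->]]; apply/asboolP.
    by exists 0; rewrite mulr0.
  by exists (a *: i + j); rewrite mulrDr; congr (_ + _); apply: mulrCA.
- move=> n z /asboolP[w ->]; apply/asboolP; exists (x * w).
  by rewrite exprSr mulrA.
have : (x ^+ n : k^o) \in J n.+1.
  by rewrite nJ ?leqnSn //; apply/asboolP; exists 1; rewrite mulr1.
move=> /asboolP[w xw]; exists w => i iI.
have [j ->] : exists j, i = x ^+ n * j.
  elim: n {nJ xw} => [|n IHn] in i iI *; first by exists i; rewrite mul1r.
  have [i' i'I ->] := xI i iI; have [j ->] := IHn i' i'I.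
  by exists j; rewrite exprS mulrA.
by rewrite mulrA -(mulrA w) -exprS (mulrC w) -xw.
Qed.

(* [I] is a vector space over the field k / ann(I), so an infinite independent
   sequence (v n) yields the strictly decreasing chain span (v j | j >= n). *)
Lemma no_minimal_nonfg : False.
Proof.
have [I0 IL] := Isub.
(* [pick t] is an element of [I] outside the span of [t]; lists not contained in [I] get the dummy
   value 0. *)
have /choice[pick pickE] (t : seq k^o) : exists v : k^o,
    (forall u, u \in t -> u \in I) -> v \in I /\ ~ span t v.
  have [tI|tI] := pselect (forall u, u \in t -> u \in I); last by exists 0.
  apply: contrapT => nv; apply: Infg; exists t; split=> // x xI.
  by apply: contrapT => nx; apply: nv; exists x.
pose s := fix s n : seq k^o := if n is m.+1 then pick (s m) :: s m else [::].
pose v n := pick (s n).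
have sI n u : u \in s n -> u \in I.
  elim: n u => //= n IHn u; rewrite inE => /orP[/eqP ->|/IHn//].
  by have [] := pickE (s n) IHn.
have vI n : v n \in I by case: (pickE (s n) (sI n)).
have vindep n : ~ span (s n) (v n) by case: (pickE (s n) (sI n)).
(* [seg n m] consists of the [m] vectors [v n], ..., [v (n + m - 1)], last one first, so [W n] is
   the span of all [v j] with [j >= n]. *)
pose seg n := fix seg m : seq k^o :=
  if m is m'.+1 then v (n + m')%N :: seg m' else [::].
pose W n : {pred k^o} := fun x => `[< exists m, span (seg n m) x >].
have segle n m d x : span (seg n m) x -> span (seg n (d + m)%N) x.
  by move=> sx; elim: d => // d IHd; apply: span_cons.
have segS n m x : span (seg n.+1 m) x -> span (seg n m.+1) x.
  elim: m x => [|m IHm] x; first by move=> ->; apply: span0.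
  by move=> [c /IHm cx]; exists c; rewrite addnS -addSn.
have sseg n m x : span (seg n m) x -> span (s (n + m)%N) x.
  elim: m x => [|m IHm] x; first by move=> ->; apply: span0.
  by rewrite addnS => -[c /IHm]; exists c.
have vseg n p : span (seg n p.+1) (v n).
  elim: p => [|p IHp]; last exact: span_cons.
  by rewrite /= addn0; apply: (span_head (v n) [::]).
have [n||n nW] := kart (I := W).
- split=> [|a x y /asboolP[m mx] /asboolP[m' my]]; apply/asboolP.
    by exists 0%N.
  exists (m + m')%N; apply: span_linear; last exact: segle.
  by rewrite addnC; apply: segle.
- move=> n x /asboolP[m mx]; apply/asboolP; exists m.+1; exact: segS.
have : v n \in W n.+1.
  by rewrite nW ?leqnSn //; apply/asboolP; exists 1%N; apply: vseg.
(* Consider the coefficient [c] of the vector of highest index. If [c] annihilates [I], the term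
   drops out; otherwise [c] is invertible on [I] and that vector lies in the span of its
   predecessors. *)
move=> /asboolP[m]; elim: m => [v0|m IHm [c cm]].
  by apply: (vindep n); rewrite v0; apply: span0.
have [c0|[d dc]] := zero_or_invertible c.
  by apply: IHm; move: cm; rewrite [_ *: _]c0 ?subr0.
apply: (vindep (n.+1 + m)%N); rewrite [X in s X]addSnnS; apply: sseg.
rewrite -(dc (v (n.+1 + m)%N)) ?vI // -mulrA; apply: (@spanZ k k^o).
rewrite -[c * _](subKr (v n)); apply: spanD.
  exact: vseg.
by apply/spanN/segS.
Qed.

End MinimalNonFinitelyGenerated.

(** The descending chain condition would turn a counterexample into a minimal one, which
    [no_minimal_nonfg] excludes. *)
Lemma ideal_fg (I : {pred k^o}) : submod_closed I -> exists t, spans t I.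
Proof.
move=> Isub; apply: contrapT => Infg.
pose F (S : {pred k^o}) := submod_closed S /\ ~ exists t, spans t S.
have [//|S []//|S [[Ssub Snfg] Smin]] := @minimal_submodule _ F I regular_fg.
apply: (no_minimal_nonfg Ssub Snfg) => T Tsub TS.
have [Tfg|Tnfg] := pselect (exists t, spans t T); [by right | left].
exact: Smin.
Qed.

(** Induction on the generators of [V]. A list [t] from [S] spanning the part of [S] in [span s] is
    enlarged by elements [w] of [S] whose coefficients at the new generator [v] generate the
    finitely generated ideal [lead_ideal s v S]. *)
Lemma noetherian_submodule (V : lmodType k) (S : {pred V}) :
  finitely_generated V -> submod_closed S -> exists t, spans t S.
Proof.
move=> /finitely_generated_span[s sV] Ssub; have [S0 SL] := Ssub.
suff [t [tS St]] : exists t : seq V, (forall v, v \in t -> v \in S) /\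
    forall x, span s x -> x \in S -> span t x.
  by exists t; split=> // x; apply: St.
elim: s {sV} => [|v s [t [tS St]]].
  by exists [::]; split=> // x ->.
have [cs [csJ Jcs]] := ideal_fg (lead_ideal_closed s v Ssub).
have [w [wS wcs]] : exists w : seq V, (forall v, v \in w -> v \in S) /\
    forall c, span cs c -> exists2 y, span w y & span s (y - (c : k) *: v).
  elim: cs csJ {Jcs} => [|c cs IHcs] csJ.
    exists [::]; split=> // c ->; exists 0 => //.
    by rewrite scale0r subr0; apply: span0.
  have [|w [wS wcs]] := IHcs.
    by move=> d dcs; apply: csJ; rewrite inE dcs orbT.
  have /asboolP[u su uS] := csJ c (mem_head _ _).
  exists ((c : k) *: v + u :: w); split=> [y|d [a /wcs[y wy sy]]].
    by rewrite inE => /orP[/eqP ->|/wS].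
  exists (a *: ((c : k) *: v + u) + y).
    by exists a; rewrite addrAC subrr add0r.
  have -> : a *: ((c : k) *: v + u) + y - (d : k) *: v =
      a *: u + (y - (d - a *: c : k) *: v).
    rewrite scalerBl scalerDr scalerA opprB -[(a *: c : k)]/(a * c).
    by rewrite -!addrA addrCA; congr (_ + _); rewrite addrCA.
  exact: span_linear su sy.
exists (w ++ t); split=> [y|x [c sx] xS].
  by rewrite mem_cat => /orP[/wS|/tS].
have [|y wy sy] := wcs c.
  by apply/Jcs/asboolP; exists (x - c *: v); rewrite // addrC subrK.
apply/span_cat; exists y, (x - y); split; rewrite ?(addrC y) ?subrK //.
apply: St; last first.
  by rewrite addrC -scaleN1r; apply: SL => //; apply: span_sub wy.
have -> : x - y = (x - c *: v) - (y - c *: v) by rewrite opprB addrA subrK.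
by apply: spanD => //; apply: spanN.
Qed.

End Artinian.

(** * Artin algebras and projective covers *)

(** A synonym of [V], so that the scalar action of [k] along [phi] does not compete with that of
    [L]. *)
Definition restriction (k L : pzRingType) (phi : {rmorphism k -> L})
  (V : lmodType L) : Type := V.

Section Restriction.
Variables (k L : pzRingType) (phi : {rmorphism k -> L}) (V : lmodType L).

HB.instance Definition _ := GRing.Zmodule.on (restriction phi V).

Definition restriction_scale (a : k) (x : restriction phi V) :
  restriction phi V := phi a *: (x : V).

Fact restriction_scaleA a b x :
  restriction_scale a (restriction_scale b x) = restriction_scale (a * b) x.
Proof. by rewrite /restriction_scale scalerA rmorphM. Qed.
Fact restriction_scale1 : left_id 1 restriction_scale.
Proof. by move=> x; rewrite /restriction_scale rmorph1 scale1r. Qed.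
Fact restriction_scaleDr : right_distributive restriction_scale +%R.
Proof. by move=> a x y; apply: scalerDr. Qed.
Fact restriction_scaleDl x : {morph restriction_scale^~ x : a b / a + b}.
Proof. by move=> a b; rewrite /restriction_scale rmorphD scalerDl. Qed.

HB.instance Definition _ := GRing.Zmodule_isLmodule.Build k (restriction phi V)
  restriction_scaleA restriction_scale1 restriction_scaleDr restriction_scaleDl.

Lemma restriction_submod (S : {pred V}) :
  submod_closed S -> submod_closed (S : {pred restriction phi V}).
Proof. by move=> [S0 SL]; split=> // a x y; apply: SL. Qed.

Lemma restriction_span (s : seq V) (x : V) :
  span (s : seq (restriction phi V)) x -> span s x.
Proof. by elim: s x => //= v s IHs x [c cx]; exists (phi c); apply: IHs. Qed.

Lemma restriction_fg n (w : 'I_n -> L) :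
    (forall x, exists c : 'I_n -> k, x = \sum_i phi (c i) * w i) ->
  finitely_generated V -> finitely_generated (restriction phi V).
Proof.
move=> wL [m [v vV]]; apply/finitely_generated_span.
exists [seq w p.2 *: v p.1 | p <- enum [set: 'I_m * 'I_n]] => x.
have [c ->] := vV x; apply: span_bigsum => i.
have [d ->] := wL (c i); rewrite scaler_suml; apply: span_bigsum => j.
rewrite -scalerA; apply: (@spanZ k (restriction phi V) _ (d j)).
by apply/span_mem/mapP; exists (i, j); rewrite ?mem_enum ?inE.
Qed.

End Restriction.

(** As [k] is commutative, the same structure map is a ring morphism into [L^c]; centrality moves
    coefficients to the other side of the generators. *)
Lemma artin_algebra_converse (L : pzRingType) :
  artin_algebra L -> artin_algebra L^c.
Proof.
move=> [k [phi [kart phiC [n [v vL]]]]].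
have psiM : monoid_morphism (phi : k -> L^c).
  by split=> [|a b]; rewrite ?rmorph1 // mulrC rmorphM.
pose psi : {rmorphism k -> L^c} :=
  HB.pack_for {rmorphism k -> L^c} (phi : k -> L^c)
    (GRing.isZmodMorphism.Build k L^c (phi : k -> L^c) (raddfB phi))
    (GRing.isMonoidMorphism.Build k L^c (phi : k -> L^c) psiM).
exists k, psi; split=> // [a x|]; first exact: esym (phiC a x).
exists n, v => x; have [c xc] := vL x; exists c; rewrite [LHS]xc.
by apply: eq_bigr => i _; apply: phiC.
Qed.

Section ArtinAlgebra.
Variable L : pzRingType.
Hypothesis hL : artin_algebra L.
Variable V : lmodType L.
Hypothesis Vfg : finitely_generated V.

Lemma artin_chain (I : nat -> {pred V}) :
    (forall n, submod_closed (I n)) -> (forall n, {subset I n.+1 <= I n}) ->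
  chain_stable I.
Proof.
have [k [phi [kart _ [n [w wL]]]]] := hL => Isub Idec.
apply: (artinian_chain kart (restriction_fg wL Vfg)) => // m.
exact: restriction_submod.
Qed.

Lemma artin_minimal (F : {pred V} -> Prop) (S0 : {pred V}) :
    F S0 -> (forall S, F S -> submod_closed S) ->
  exists S, F S /\ forall T, F T -> {subset T <= S} -> {subset S <= T}.
Proof.
have [k [phi [kart _ [n [w wL]]]]] := hL => FS0 Fsub.
apply: (minimal_submodule kart (restriction_fg wL Vfg) FS0) => S /Fsub.
exact: restriction_submod.
Qed.

(** Over [k] the module is Noetherian, and generators over [k] also generate over [L]. *)
Lemma artin_submod_fg (S : {pred V}) (hS : submod_closed S) :
  finitely_generated (submod hS).
Proof.
have [k [phi [kart _ [n [w wL]]]]] := hL.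
have [t [tS St]] := noetherian_submodule kart (restriction_fg wL Vfg)
  (restriction_submod phi hS).
apply/finitely_generated_span.
have [t' tE] : exists t' : seq (submod hS), [seq submod_val x | x <- t'] = t.
  elim: t tS {St} => [|v t IHt] tS; first by exists [::].
  have [|t' <-] := IHt; first by move=> u ut; apply: tS; rewrite inE ut orbT.
  have [y <-] := submod_val_ex hS (tS v (mem_head _ _)).
  by exists (y :: t').
exists t' => x; have {St} := restriction_span (St _ (submod_valP x)).
rewrite -tE; elim: t' x {t tS tE} => [|v t IHt] x.
  by move=> x0; apply: (@submod_val_inj _ _ _ hS); rewrite linear0.
move=> [c cx]; exists c; apply: IHt; move: cx.
by rewrite -linearZ -linearB.
Qed.

Lemma artin_ker_fg (W : lmodType L) (f : {linear V -> W}) :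
  finitely_generated (ker f).
Proof. exact: artin_submod_fg. Qed.

End ArtinAlgebra.

(** * Powers of endomorphisms and Fitting-type identities *)

Section Iterate.
Variables (R : pzRingType) (P : lmodType R).
Implicit Types psi : {linear P -> P}.

Fixpoint linear_iter n psi : {linear P -> P} :=
  if n is m.+1 then psi \o linear_iter m psi else idfun.

Lemma linear_iterD m n psi x :
  linear_iter (m + n) psi x = linear_iter m psi (linear_iter n psi x).
Proof. by elim: m => //= m ->. Qed.

Lemma linear_iterSr n psi x :
  linear_iter n.+1 psi x = linear_iter n psi (psi x).
Proof. by rewrite -addn1 linear_iterD. Qed.

End Iterate.

Lemma linear_iter_dual (R : pzRingType) (P : lmodType R) n
    (psi : {linear P -> P}) (f : dual P) x :
  dual_fun (linear_iter n (dual_map psi) f) x =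
    dual_fun f (linear_iter n psi x).
Proof.
elim: n x => // n IHn x; rewrite [in RHS]linear_iterSr -IHn.
by [].
Qed.

(** The images of the powers of [psi] stabilize, so for large [n] the n-th power takes values in the
    image of the 2n-th, and projectivity of [P] lifts it. *)
Lemma fitting_right (L : pzRingType) (hL : artin_algebra L) (P : lmodType L)
    (psi : {linear P -> P}) :
    finitely_generated P -> projective P ->
  exists N, forall n, (N <= n)%N -> exists a : {linear P -> P},
    forall x, linear_iter (n + n) psi (a x) = linear_iter n psi x.
Proof.
move=> Pfg Pproj.
pose I n := image_pred (linear_iter n psi).
have [||N NI] := artin_chain hL Pfg (I := I).
- by move=> n; apply: image_submod_closed.
- move=> n y /asboolP[x <-]; apply/asboolP; exists (psi x).
  by rewrite linear_iterSr.
exists N => n Nn; apply: projective_lift => // q; apply/asboolP.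
rewrite -[asbool _]/(linear_iter n psi q \in I (n + n)%N).
rewrite NI ?(leq_trans Nn) ?leq_addr // -(NI n) //.
by apply/asboolP; exists q.
Qed.

(* The dual basis transports a right solution for the transpose of [psi] over
   the opposite algebra to a left solution for [psi]. *)
Lemma fitting_left (L : pzRingType) (hL : artin_algebra L) (P : lmodType L)
    (psi : {linear P -> P}) :
    finitely_generated P -> projective P ->
  exists N, forall n, (N <= n)%N -> exists b : {linear P -> P},
    forall x, b (linear_iter (n + n) psi x) = linear_iter n psi x.
Proof.
move=> Pfg Pproj; have Pdb : has_dual_basis P by apply/dual_basisP.
have /dual_basisP[dPfg dPproj] := dual_basis_dual Pdb.
have [N NP] :=
  fitting_right (artin_algebra_converse hL) (dual_map psi) dPfg dPproj.
exists N => n /NP[a aE]; have [m [v [f vf]]] := Pdb.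
have bL : linear (fun x => \sum_i (dual_fun (a (f i)) x : L) *: v i).
  move=> c x y; rewrite scaler_sumr -big_split; apply: eq_bigr => i _.
  by rewrite /dual_fun linearP scalerDl scalerA.
exists (mk_linear bL) => x; rewrite [RHS]vf; apply: eq_bigr => i _.
by rewrite -!linear_iter_dual aE.
Qed.

(** * Projective covers, minimal presentations and finitely generated resolutions *)

Section Covers.
Variable L : pzRingType.
Hypothesis hL : artin_algebra L.

Lemma projective_cover (M : lmodType L) :
    finitely_generated M ->
  exists (P : lmodType L) (p : {linear P -> M}),
    [/\ finitely_generated P, projective P, surjective p
      & superfluous_kernel p].
Proof.
move=> /finitely_generatedP[n [p psurj]].
set F := free_module L n in p psurj *.
have Fproj : projective F := @free_module_projective L n.
have Ffg : finitely_generated F := free_module_fg L n.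
(* The members of [fam] are the summands of [F] cut out by idempotents [e] compatible with [p]. A
   minimal one will be the projective cover. *)
pose fam (S : {pred F}) := exists e : {linear F -> F},
  [/\ forall x, e (e x) = e x, forall x, p (e x) = p x
    & forall x, x \in S <-> e x = x].
have famsub S : fam S -> submod_closed S.
  move=> [e [_ _ SE]]; split=> [|a x y /SE ex /SE ey]; apply/SE.
    by rewrite linear0.
  by rewrite linearP ex ey.
have [|S [Sfam Smin]] := artin_minimal hL Ffg (F := fam) (S0 := predT) _ famsub.
  by exists idfun.
have [e [ee pe SE]] := Sfam; have hS := famsub S Sfam.
have eS x : e x \in S by apply/SE.
have [r rE] := corestriction hS eS.
pose q : {linear submod hS -> M} := p \o submod_val.
have rsurj : surjective r.
  move=> x; exists (submod_val x); apply: (@submod_val_inj _ _ _ hS).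
  by rewrite rE; apply/SE/submod_valP.
exists (submod hS), q; split.
- exact: finitely_generated_image rsurj Ffg.
- apply: (@projective_retract _ _ F r submod_val) => // x.
  by apply: (@submod_val_inj _ _ _ hS); rewrite rE; apply/SE/submod_valP.
- move=> y; have [x <-] := psurj y; exists (r x).
  by rewrite /q /= -[sval _]/(submod_val _) rE pe.
move=> S' S'sub S'M x0.
pose j : {linear submod S'sub -> F} := submod_val \o submod_val.
(* Since [S'] meets every fibre of [q], [p] lifts through [S']; the resulting endomorphism [psi] of
   [F] satisfies [p \o psi = p] and has image in [S']. *)
have [x|psi' psiE] := @projective_lift _ F _ _ (p \o j) p Fproj.
  have [y yS' /eqP] := S'M (r x); rewrite linearB subr_eq0 => /eqP xy.
  have [t tE] := submod_val_ex S'sub yS'; exists t.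
  transitivity (q y); first by rewrite -tE.
  by rewrite -xy /q -[LHS]/(p (submod_val (r x))) rE pe.
pose psi : {linear F -> F} := j \o psi'.
have [N1 N1P] := fitting_right hL psi Ffg Fproj.
have [N2 N2P] := fitting_left hL psi Ffg Fproj.
(* The successor makes [m] positive, so that the power [x] of [psi] still takes values in the image
   of [j]. *)
pose m := (maxn N1 N2).+1.
have [|a aE] := N1P m; first by rewrite leqW ?leq_maxl.
have [|b bE] := N2P m; first by rewrite leqW ?leq_maxr.
pose x := linear_iter m psi.
have px y : p (x y) = p y.
  rewrite /x; elim: m {aE bE x} => //= m' IHm; rewrite -IHm.
  exact: psiE.
have xxa y : x (x (a y)) = x y by rewrite -[LHS]linear_iterD aE.
have bxx y : b (x (x y)) = x y by rewrite /x -linear_iterD bE.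
(* The two Fitting identities give [x \o a = b \o x], which makes [e'] idempotent. Its fixed points
   are a member of [fam] inside [S'], so minimality of [S] forces [S'] to be everything. *)
pose e' : {linear F -> F} := x \o a.
have e'b y : e' y = b (x y) by rewrite -[in RHS]xxa bxx.
pose S'' : {pred F} := [pred y | e' y == y].
have S''j y : y \in S'' -> exists t, j t = y.
  by rewrite inE => /eqP <-; eexists.
have S''fam : fam S''.
  exists e'; split=> [y|y|y]; last by split; [move/eqP | move=> ?; apply/eqP].
    by rewrite [LHS]e'b -[e' y in LHS]/(x (a y)) xxa -e'b.
  by rewrite -[LHS]px -[e' y]/(x (a y)) xxa px.
have [|t tE] := S''j (submod_val x0).
  apply: Smin => //; last exact: submod_valP.
  by move=> z /S''j[t <-]; apply: submod_valP.
by rewrite -(submod_val_inj _ _ tE) submod_valP.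
Qed.

Lemma minimal_presentation_exists (M : lmodType L) :
  finitely_generated M -> inhabited (minimal_projective_presentation M).
Proof.
move=> Mfg; have [P0 [p0 [P0fg P0proj p0surj p0min]]] := projective_cover Mfg.
have [P1 [p1 [P1fg P1proj p1surj p1min]]] :=
  projective_cover (artin_ker_fg hL P0fg p0).
split.
apply: (@MinimalProjectivePresentation _ _ P1 P0 (ker_val \o p1) p0) => //.
  move=> x; split=> [/ker_val_ex[y <-]|[y <-]]; last exact: ker_valP.
  by have [z <-] := p1surj y; exists z.
move=> S Ssub SP1; apply: p1min => // x; have [y yS xy] := SP1 x.
by exists y => //; apply: ker_val_inj; rewrite linear0.
Qed.

(** Bundling finite generation with the module lets [syzygy] be iterated. *)
Definition fg_module := {M : lmodType L | finitely_generated M}.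

Definition free_cover (M : fg_module) :
    {n : nat & {p : {linear free_module L n -> sval M} | surjective p}} :=
  let: exist n np := cid (proj1 (finitely_generatedP (sval M)) (svalP M)) in
  let: exist p psurj := cid np in existT _ n (exist _ p psurj).

Definition cover_map M :
    {linear free_module L (projT1 (free_cover M)) -> sval M} :=
  sval (projT2 (free_cover M)).

Definition syzygy (M : fg_module) : fg_module :=
  exist _ (ker (cover_map M))
    (artin_ker_fg hL (free_module_fg L _) (cover_map M)).

Lemma resolution_exists (M : lmodType L) :
    finitely_generated M ->
  exists P : projective_resolution M,
    forall i, finitely_generated (res_obj P i).
Proof.
move=> Mfg; pose Z i := iter i syzygy (exist _ M Mfg).
pose d i : {linear _ -> free_module L (projT1 (free_cover (Z i)))} :=
  ker_val \o cover_map (Z i.+1).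
have csurj i : surjective (cover_map (Z i)).
  exact: svalP (projT2 (free_cover (Z i))).
have exact_ i x : cover_map (Z i) x = 0 <-> exists y, d i y = x.
  split=> [/ker_val_ex[y <-]|[y <-]]; last exact: ker_valP.
  by have [z <-] := csurj i.+1 y; exists z.
have dexact i x : d i x = 0 <-> exists y, d i.+1 y = x.
  rewrite -exact_; split=> [|cx]; last by rewrite /d /= cx.
  by move=> dx; apply: ker_val_inj; rewrite linear0.
exists (@ProjectiveResolution _ _ _ d (cover_map (Z 0))
  (fun i => @free_module_projective _ _) (csurj 0) (exact_ 0) dexact) => i.
exact: free_module_fg.
Qed.

End Covers.

(** * Vanishing of Ext *)

Lemma res_objP (R : pzRingType) (M : lmodType R)
  (P : projective_resolution M) i : projective (res_obj P i).
Proof. exact: res_projective. Qed.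

Arguments res_objP [R M] P i.

Lemma res_diff_diff (R : pzRingType) (M : lmodType R)
  (P : projective_resolution M) i x : res_diff P i (res_diff P i.+1 x) = 0.
Proof. by apply/res_exact; exists x. Qed.

Lemma res_aug_diff (R : pzRingType) (M : lmodType R)
  (P : projective_resolution M) x : res_aug P (res_diff P 0 x) = 0.
Proof. by apply/res_aug_exact; exists x. Qed.

(** Vanishing of Ext^i(M, N) for all i >= 1, computed on the single resolution [P]; the index [i]
    here stands for degree [i.+1]. *)
Definition acyclic (R : pzRingType) (M : lmodType R)
    (P : projective_resolution M) (N : lmodType R) : Prop :=
  forall i (f : {linear res_obj P i.+1 -> N}),
    (forall x, f (res_diff P i.+1 x) = 0) ->
    exists g : {linear res_obj P i -> N}, forall x, f x = g (res_diff P i x).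

Definition Ext_all (R : pzRingType) (M N : lmodType R) : Prop :=
  forall i, (1 <= i)%N -> Ext_vanishes i M N.

Lemma Ext_allP (R : pzRingType) (M N : lmodType R) :
  Ext_all M N <-> forall P : projective_resolution M, acyclic P N.
Proof.
split=> [MN P i f fd|MN [//|i] _ P f fd]; last exact: MN fd.
exact: (MN i.+1 isT P f fd).
Qed.

(** * Independence of the chosen resolution *)

Section Comparison.
Variables (R : pzRingType) (M N : lmodType R) (P P' : projective_resolution M).

(* Chain maps phi and psi in degree i, together with the part t of
   [psi \o phi - id] that the next homotopy component has to kill. *)
Definition comparison_at i : Prop :=
  exists (phi : {linear res_obj P i -> res_obj P' i})
         (psi : {linear res_obj P' i -> res_obj P i})
         (t : {linear res_obj P i -> res_obj P i}),
  [/\ forall x, exists y, res_diff P' i y = phi (res_diff P i x),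
      forall x, exists y, res_diff P i y = psi (res_diff P' i x),
      forall x, exists y, res_diff P i y = t x
    & forall x, t (res_diff P i x) =
        psi (phi (res_diff P i x)) - res_diff P i x].

(** Projectivity lifts both chain maps one degree and yields the homotopy component [h]. What is
    left of [psi1 \o phi1 - id] after subtracting [h \o d] is a cycle, hence a boundary. *)
Lemma comparison_next i : comparison_at i ->
  exists (phi : {linear res_obj P i -> res_obj P' i})
         (phi1 : {linear res_obj P i.+1 -> res_obj P' i.+1})
         (psi1 : {linear res_obj P' i.+1 -> res_obj P i.+1})
         (h : {linear res_obj P i -> res_obj P i.+1}),
  [/\ forall x, res_diff P' i (phi1 x) = phi (res_diff P i x),
      forall x, exists y, res_diff P i.+1 y = psi1 (res_diff P' i.+1 x)
    & forall x, exists y, res_diff P i.+1 y =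
        psi1 (phi1 x) - x - h (res_diff P i x)].
Proof.
move=> [phi [psi [t [phiB psiB tB tE]]]].
have [phi1 phi1E] := @projective_lift _ _ _ _ (res_diff P' i)
  (phi \o res_diff P i) (res_objP P i.+1) phiB.
have [psi1 psi1E] := @projective_lift _ _ _ _ (res_diff P i)
  (psi \o res_diff P' i) (res_objP P' i.+1) psiB.
have [h hE] := projective_lift (res_objP P i) tB.
exists phi, phi1, psi1, h; split=> // x; apply/res_exact.
  by rewrite psi1E /= res_diff_diff linear0.
by rewrite !linearB psi1E /= phi1E /= hE tE subrr.
Qed.

Lemma comparison i : comparison_at i.
Proof.
elim: i => [|i /comparison_next[phi [phi1 [psi1 [h [phi1E psi1B hB]]]]]].
  have [x|phi phiE] := @projective_lift _ _ _ _ (res_aug P') (res_aug P)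
    (res_objP P 0); first exact: (res_aug_surj P').
  have [x|psi psiE] := @projective_lift _ _ _ _ (res_aug P) (res_aug P')
    (res_objP P' 0); first exact: (res_aug_surj P).
  exists phi, psi, ((psi \o phi) \- idfun); split=> // x; apply/res_aug_exact.
  - by rewrite phiE res_aug_diff.
  - by rewrite psiE res_aug_diff.
  - by rewrite linearB /= psiE phiE subrr.
exists phi1, psi1, ((psi1 \o phi1) \- idfun \- (h \o res_diff P i)).
split=> // x; last by rewrite /= res_diff_diff linear0 subr0.
by apply/res_exact; rewrite phi1E res_diff_diff linear0.
Qed.

(** A cocycle [f] kills boundaries, so the homotopy gives [f = f \o psi1 \o phi1 - f \o h \o d]. The
    cocycle [f \o psi1] on [P'] is a coboundary, so both terms factor through [d]. *)
Lemma acyclic_independent : acyclic P' N -> acyclic P N.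
Proof.
move=> P'N i f fd.
have [phi [phi1 [psi1 [h [phi1E psi1B hB]]]]] := comparison_next (comparison i).
have [x|g gE] := P'N i (f \o psi1).
  by have [y /= <-] := psi1B x; rewrite fd.
exists ((g \o phi) \- (f \o h)) => x; have [y yE] := hB x.
have := gE (phi1 x); rewrite /= phi1E => <-.
have := fd y; rewrite yE !linearB => /eqP.
by rewrite subr_eq0 subr_eq addrC -subr_eq => /eqP.
Qed.

End Comparison.

Lemma Ext_all_acyclic (R : pzRingType) (M N : lmodType R)
  (P : projective_resolution M) : acyclic P N -> Ext_all M N.
Proof. by move=> PN; apply/Ext_allP => P'; apply: acyclic_independent PN. Qed.

(** * Dimension shifting along a short exact sequence *)

Section DimensionShift.
Variables (R : pzRingType) (M : lmodType R) (P : projective_resolution M).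

Lemma acyclic_dual_basis (Q : lmodType R) :
  has_dual_basis Q -> acyclic P R^o -> acyclic P Q.
Proof.
move=> [n [v [e vf]]] PR i f fd.
have /choice[u uE] (j : 'I_n) : exists u : {linear res_obj P i -> R^o},
    forall x, dual_fun (e j) (f x) = u (res_diff P i x).
  apply: (PR i ((e j : {linear Q -> R^o}) \o f)) => x.
  by rewrite /= fd linear0.
have gL : linear (fun x => \sum_j (u j x : R) *: v j).
  move=> a x y; rewrite scaler_sumr -big_split; apply: eq_bigr => j _.
  by rewrite linearP scalerDl scalerA.
exists (mk_linear gL) => x; rewrite [LHS]vf; apply: eq_bigr => j _.
by rewrite uE.
Qed.

Variables (A B C : lmodType R) (j : {linear A -> B}) (q : {linear B -> C}).
Hypotheses (jinj : injective j) (jq : forall x, q (j x) = 0).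
Hypothesis qj : forall b, q b = 0 -> exists a, j a = b.
Hypothesis PA : acyclic P A.

(** Exactness of Ext^i(M, B) -> Ext^i(M, C) -> Ext^(i+1)(M, A), made explicit: [f] lifts to [h] into
    [B], the connecting cocycle [c] bounds some [a], and [h - j \o a] is a cocycle in [B]. *)
Lemma acyclic_coker : surjective q -> acyclic P B -> acyclic P C.
Proof.
move=> qsurj PB i f fd.
have [x|h hE] := @projective_lift _ _ _ _ q f (res_objP P i.+1).
  exact: qsurj.
have [x|c cE] := @coinduced_injective _ _ _ _ j (h \o res_diff P i.+1) jinj.
  by apply: qj; rewrite /= hE fd.
have [x|a aE] := PA (f := c).
  by apply: jinj; rewrite cE /= res_diff_diff !linear0.
have [x|b bE] := PB i (h \- (j \o a)).
  by rewrite /= -aE cE subrr.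
by exists (q \o b) => x; rewrite /= -bE /= linearB jq subr0 hE.
Qed.

(** The obstruction to lifting lies in Ext^1(M, A). A lift on degree 0 of [P], corrected by
    [j \o a], vanishes on boundaries and descends to [M]. *)
Lemma acyclic_lift (f : {linear M -> C}) :
    (forall x, exists b, q b = f x) ->
  exists g : {linear M -> B}, forall x, q (g x) = f x.
Proof.
move=> fq.
have [x|h hE] := @projective_lift _ _ _ _ q (f \o res_aug P)
  (res_objP P 0); first exact: fq.
have [x|c cE] := @coinduced_injective _ _ _ _ j (h \o res_diff P 0) jinj.
  by apply: qj; rewrite /= hE /= res_aug_diff linear0.
have [x|a aE] := PA (f := c).
  by apply: jinj; rewrite cE /= res_diff_diff !linear0.
have [x /res_aug_exact[y <-]|g gE] :=
    factor_through (f := h \- (j \o a)) (res_aug_surj P).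
  by rewrite /= -aE cE subrr.
exists g => x; have [y <-] := res_aug_surj P x.
by rewrite gE linearB jq subr0 hE.
Qed.

End DimensionShift.

Lemma acyclic_retract (R : pzRingType) (M N N' : lmodType R)
    (P : projective_resolution M)
    (r : {linear N -> N'}) (s : {linear N' -> N}) :
  (forall x, r (s x) = x) -> acyclic P N -> acyclic P N'.
Proof.
move=> rs PN i f fd; have [x|g gE] := PN i (s \o f).
  by rewrite /= fd linear0.
by exists (r \o g) => x; rewrite /= -gE /= rs.
Qed.

(** Composing its augmentation with [h'] makes a resolution of [M'] one of [M], with the same
    underlying complex. *)
Lemma Ext_all_iso (R : pzRingType) (M M' N : lmodType R)
    (h : {linear M -> M'}) (h' : {linear M' -> M}) :
  (forall x, h' (h x) = x) -> (forall x, h (h' x) = x) ->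
  Ext_all M N -> Ext_all M' N.
Proof.
move=> hK h'K /Ext_allP MN; apply/Ext_allP => P.
have asurj : surjective (h' \o res_aug P).
  by move=> x; have [y yx] := res_aug_surj P (h x); exists y; rewrite /= yx.
have aexact x : (h' \o res_aug P) x = 0 <-> exists y, res_diff P 0 y = x.
  rewrite -res_aug_exact /=; split=> [hx|->]; last by rewrite linear0.
  by rewrite -[LHS]h'K hx linear0.
exact: (MN (@ProjectiveResolution R M _ (res_diff P) _ (res_objP P) asurj aexact
  (@res_exact _ _ P))).
Qed.

Lemma bijective_inverse (R : pzRingType) (M M' : lmodType R)
    (h : {linear M -> M'}) : injective h -> surjective h ->
  exists h' : {linear M' -> M},
    (forall x, h' (h x) = x) /\ (forall x, h (h' x) = x).
Proof.
move=> hinj hsurj; have [h' hh'] := coinduced_injective (f := idfun) hinj hsurj.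
by exists h'; split=> // x; apply: hinj; rewrite hh'.
Qed.

(** * Transport from a reflexive module to its bidual *)

Section Bidual.
Variable Phi : forall R : pzRingType, lmodType R -> Prop.
Hypothesis Phi_iso : forall (R : pzRingType) (M M' : lmodType R)
  (h : {linear M -> M'}), injective h -> surjective h -> Phi M -> Phi M'.

(** Eliminating [e] turns the semilinear bijection into a linear one, under which [Phi] is
    invariant. *)
Lemma semilinear_transport (R R' : pzRingType) (e : R = R')
    (M : lmodType R) (M' : lmodType R') (h : M -> M') :
    (forall a x y, h (a *: x + y) =
       eq_rect R (fun S : pzRingType => S) a R' e *: h x + h y) ->
  injective h -> surjective h -> Phi M -> Phi M'.
Proof.
by case: _ / e M' h => M' h hL; apply: (@Phi_iso R M M' (mk_linear hL)).
Qed.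

(* [dual (dual M)] is a module over [(R^c)^c], which equals [R] only
   propositionally. *)
Lemma bidual_transport (R : pzRingType) (M : lmodType R) :
  reflexive_module M -> Phi M -> Phi (dual (dual M)).
Proof.
move=> [Msep Mrefl].
apply: (@semilinear_transport _ _ (esym (converseK R)) M _ (@eval R M)).
- move=> a x y.
  (* The carriers of [R] and [(R^c)^c] are convertible, so by proof irrelevance the induced equality
     of types is [erefl] and transport fixes [a]. *)
  have -> : eq_rect R (fun S : pzRingType => S) a _ (esym (converseK R)) = a.
    move: (esym _) => e.
    have -> : eq_rect R (fun S : pzRingType => S) a _ e =
        eq_rect (R : Type) id a _ (congr1 (fun S : pzRingType => S : Type) e).
      by case: _ / e.
    by rewrite (Prop_irrelevance (congr1 _ e) (erefl (R : Type))).
  by apply: dual_ext => f; apply: (linearP (f : {linear M -> R^o})).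
- by move=> x y xy; apply: separated_eq => // f; rewrite -[LHS]/(eval x f) xy.
- by move=> u; have [x ->] := Mrefl u; exists x.
Qed.

End Bidual.

Lemma Ext_all_bidual_regular (R : pzRingType) (M : lmodType R) :
  reflexive_module M -> Ext_all M R^o -> Ext_all (dual (dual M)) ((R^c)^c)^o.
Proof.
apply: (@bidual_transport (fun R M => @Ext_all R M R^o)) => {}R {}M M' h hi hs.
by have [h' [hK h'K]] := bijective_inverse hi hs; apply: Ext_all_iso hK h'K.
Qed.

Lemma Ext_all_bidual_self (R : pzRingType) (M : lmodType R) :
  reflexive_module M -> Ext_all M M -> Ext_all (dual (dual M)) (dual (dual M)).
Proof.
apply: (@bidual_transport (fun R M => @Ext_all R M M)) => {}R {}M M' h hi hs MM.
have [h' [hK h'K]] := bijective_inverse hi hs; apply: (Ext_all_iso hK h'K).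
apply/Ext_allP => P; apply: (acyclic_retract h'K).
by move/Ext_allP: MM; apply.
Qed.

Lemma projective_Ext_all (R : pzRingType) (M N : lmodType R) :
  projective M -> Ext_all M N.
Proof.
move=> Mproj.
(* [M] resolves itself in degree 0; [free_module R 0] is the zero module. *)
pose obj i := if i is 0 then M else free_module R 0.
pose d i : {linear obj i.+1 -> obj i} := \0.
have trivial_ i (x : obj i.+1) : x = 0 by apply/ffunP; case.
have objP i : projective (obj i).
  by case: i => [//|i]; apply: free_module_projective.
have augsurj : surjective (idfun : {linear obj 0 -> M}) by move=> x; exists x.
have augexact x : (idfun : {linear obj 0 -> M}) x = 0 <-> exists y, d 0 y = x.
  by split=> [x0|[y <-] //]; exists 0; apply: esym x0.
have dexact i x : d i x = 0 <-> exists y, d i.+1 y = x.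
  by split=> // _; exists 0; rewrite (trivial_ i x).
apply: (@Ext_all_acyclic R M N
  (ProjectiveResolution objP augsurj augexact dexact)) => i f _.
by exists \0 => x; rewrite (trivial_ i x) linear0.
Qed.

Lemma dual_map_inj (R : pzRingType) (M N : lmodType R) (p : {linear M -> N}) :
  surjective p -> injective (dual_map p).
Proof.
move=> psurj f g fg; apply: dual_ext => y; have [x <-] := psurj y.
by rewrite -[LHS]/(dual_fun (dual_map p f) x) fg.
Qed.

(** * Gorenstein projective modules *)

Section Splice.
Variables (R : pzRingType) (M P1 P0 : lmodType R).
Variables (p : {linear P1 -> P0}) (pi : {linear P0 -> M}).
Hypotheses (P1db : has_dual_basis P1) (P0db : has_dual_basis P0).
Hypotheses (pi_surj : surjective pi)
  (pi_exact : forall x, pi x = 0 <-> exists y, p y = x).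
Variable Q : projective_resolution (dual M).

(** The terms of a resolution of the transpose; [Q] is shifted by two degrees, so Ext^(i+2) of the
    transpose is Ext^i of [dual M] for i >= 1. *)
Definition splice_obj i : lmodType R^c :=
  match i with 0 => dual P1 | 1 => dual P0 | j.+2 => res_obj Q j end.

Definition splice_diff i : {linear splice_obj i.+1 -> splice_obj i} :=
  match i with
  | 0 => dual_map p
  | 1 => dual_map pi \o res_aug Q
  | j.+2 => res_diff Q j
  end.

Lemma splice_projective i : projective (splice_obj i).
Proof.
case: i => [|[|i]]; last exact: res_objP.
  by have /dual_basisP[] := dual_basis_dual P1db.
by have /dual_basisP[] := dual_basis_dual P0db.
Qed.

Lemma splice_aug_exact x :
  coker_proj (dual_map p) x = 0 <-> exists y, splice_diff 0 y = x.
Proof.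
rewrite -(linear0 (coker_proj (dual_map p))) coker_projP.
by split=> -[y yx]; exists y; rewrite yx subr0.
Qed.

(** Duality is left exact, so the kernel of [dual_map p] is the image of the injection
    [dual_map pi], and [Q] covers [dual M]. *)
Lemma splice_exact i x :
  splice_diff i x = 0 <-> exists y, splice_diff i.+1 y = x.
Proof.
case: i x => [|[|i]] x; last exact: res_exact.
  split=> [x0|[y <-]]; last first.
    apply: dual_ext => z; rewrite -[LHS]/(dual_fun (res_aug Q y) (pi (p z))).
    have -> : pi (p z) = 0 by apply/pi_exact; exists z.
    by rewrite /dual_fun linear0.
  have [y /pi_exact[z <-]|m mE] :=
      factor_through (f := x : {linear P0 -> R^o}) pi_surj.
    by rewrite -[LHS]/(dual_fun (dual_map p x) z) x0.
  have [y ym] := res_aug_surj Q (m : dual M); exists y.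
  by apply: dual_ext => z; rewrite /= ym; apply: mE.
rewrite -res_aug_exact; split=> [x0|/= ->]; last by rewrite linear0.
by apply: (dual_map_inj pi_surj); rewrite linear0.
Qed.

Definition splice : projective_resolution (coker (dual_map p)) :=
  @ProjectiveResolution _ (coker (dual_map p)) _ splice_diff
    (coker_proj (dual_map p))
    splice_projective (@coker_proj_surj _ _ _ (dual_map p))
    splice_aug_exact splice_exact.

(** This reads off Auslander's exact sequence 0 -> Ext^1(Tr M, R) -> M -> M'' -> Ext^2(Tr M, R) ->
    0: [Tac 0] makes [eval] injective, [Tac 1] makes it onto, and the higher degrees are those of
    [Q]. *)
Lemma splice_acyclic_reflexive :
  acyclic splice (R^c)^o -> reflexive_module M /\ acyclic Q (R^c)^o.
Proof.
move=> Tac; split; last by move=> i f fd; apply: (Tac i.+2 f fd).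
have [_ P1refl] := dual_basis_reflexive P1db.
have [P0sep P0refl] := dual_basis_reflexive P0db.
split=> [x x0|U].
  have [y yx] := pi_surj x; rewrite -yx; apply/pi_exact.
  have [q|g gE] := Tac 0 (eval y : {linear dual P0 -> (R^c)^o}).
    by rewrite -[LHS]/(dual_fun (res_aug Q q) (pi y)) yx.
  have [z zg] := P1refl (g : dual (dual P1)); exists z.
  apply: separated_eq => // u.
  transitivity (g (dual_map p u)); last exact: esym (gE u).
  by rewrite -[RHS]/(dual_fun (g : dual (dual P1)) (dual_map p u)) zg.
have [q|g gE] := Tac 1 ((U : {linear dual M -> (R^c)^o}) \o res_aug Q).
  by rewrite /= res_aug_diff linear0.
have [y yg] := P0refl (g : dual (dual P0)); exists (pi y).
apply: dual_ext => n; have [q <-] := res_aug_surj Q n.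
rewrite -[LHS]/(((U : {linear dual M -> (R^c)^o}) \o res_aug Q) q) gE.
rewrite -[LHS]/(dual_fun (g : dual (dual P0)) (dual_map pi (res_aug Q q))).
by rewrite yg.
Qed.

(** Conversely, injectivity of [eval] settles degree 1 and surjectivity degree 2. *)
Lemma splice_acyclic :
  reflexive_module M -> acyclic Q (R^c)^o -> acyclic splice (R^c)^o.
Proof.
move=> [Msep Mrefl] Qac [|[|i]] f fd; last exact: Qac.
  have [_ P0refl] := dual_basis_reflexive P0db.
  have [x xf] := P0refl (f : dual (dual P0)).
  have /pi_exact[y yx] : pi x = 0.
    apply: Msep => n; have [q <-] := res_aug_surj Q n.
    rewrite -[LHS]/(dual_fun (eval x) (dual_map pi (res_aug Q q))) -xf.
    exact: fd.
  exists (eval y : {linear dual P1 -> (R^c)^o}) => u.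
  rewrite -[LHS]/(dual_fun (f : dual (dual P0)) u) xf.
  by rewrite -[LHS]/(dual_fun u x) -yx.
have [q /res_aug_exact[y <-]|U UE] := factor_through (f := f) (res_aug_surj Q).
  exact: fd.
have [m mU] := Mrefl (U : dual (dual M)); have [x xm] := pi_surj m.
exists (eval x : {linear dual P0 -> (R^c)^o}) => q.
rewrite -UE -[LHS]/(dual_fun (U : dual (dual M)) (res_aug Q q)) mU -xm.
by [].
Qed.

End Splice.

Section GorensteinProjective.
Variables (R : pzRingType) (M : lmodType R).
Variable Q : projective_resolution (dual M).

Lemma Gorenstein_projective_reflexive (p : minimal_projective_presentation M) :
    Gorenstein_projective M ->
  [/\ Ext_all M R^o, reflexive_module M & acyclic Q (R^c)^o].
Proof.
move=> [MR TrM]; have /Ext_allP TrR := TrM p.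
have P1db : has_dual_basis (pres1 p).
  by apply/dual_basisP; split; [exact: pres1_fg | exact: @pres1_projective].
have P0db : has_dual_basis (pres0 p).
  by apply/dual_basisP; split; [exact: pres0_fg | exact: @pres0_projective].
have [] := splice_acyclic_reflexive (TrR (splice P1db P0db (pres_aug_surj p)
  (@pres_exact _ _ p) Q)).
by split.
Qed.

Lemma reflexive_Gorenstein_projective :
    Ext_all M R^o -> reflexive_module M -> acyclic Q (R^c)^o ->
  Gorenstein_projective M.
Proof.
move=> MR Mrefl Qac; split=> // p.
have P1db : has_dual_basis (pres1 p).
  by apply/dual_basisP; split; [exact: pres1_fg | exact: @pres1_projective].
have P0db : has_dual_basis (pres0 p).
  by apply/dual_basisP; split; [exact: pres0_fg | exact: @pres0_projective].
exact: (Ext_all_acyclic (@splice_acyclic _ _ _ _ _ _ P1db P0db (pres_aug_surj p)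
  (@pres_exact _ _ p) Q Mrefl Qac)).
Qed.

End GorensteinProjective.

(** * Self-extensions of the dual *)

Section DualSelfExtensions.
Variables (S : pzRingType) (N : lmodType S).
Variables (Q : projective_resolution N) (P : projective_resolution (dual N)).
Hypotheses (Qfg : forall i, finitely_generated (res_obj Q i))
  (Qac : acyclic Q S^o) (Nrefl : reflexive_module N)
  (PR : acyclic P (S^c)^o) (PN : acyclic P (dual N)).

Definition dual_cocycles i : lmodType S^c := ker (dual_map (res_diff Q i)).

Lemma dual_diff_cocycle i :
  exists q : {linear dual (res_obj Q i) -> dual_cocycles i.+1},
    forall u, ker_val (q u) = dual_map (res_diff Q i) u.
Proof.
apply: (coinduced_injective (@ker_val_inj _ _ _ _)) => u.
apply: ker_val_ex; apply: dual_ext => x.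
rewrite -[LHS]/(dual_fun u (res_diff Q i (res_diff Q i.+1 x))) res_diff_diff.
by rewrite /dual_fun linear0.
Qed.

Lemma dual_diff_ker i (q : {linear dual (res_obj Q i) -> dual_cocycles i.+1}) :
    (forall u, ker_val (q u) = dual_map (res_diff Q i) u) ->
  (forall z : dual_cocycles i, q (ker_val z) = 0) /\
  (forall u, q u = 0 -> exists z : dual_cocycles i, ker_val z = u).
Proof.
move=> qE; split=> [z|u u0].
  by apply: ker_val_inj; rewrite qE linear0; apply: ker_valP.
by apply: ker_val_ex; apply: etrans (esym (qE u)) _; rewrite u0 linear0.
Qed.

(** Dimension shifting along 0 -> Z_i -> Q_i' -> Z_(i+1) -> 0, exact on the right because
    Ext^(i+1)(N, S) = 0. The start Z_0 is N' by left exactness, and each Q_i' is finitely generated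
    projective, so [PR] covers the middle term. *)
Lemma acyclic_dual_cocycles i : acyclic P (dual_cocycles i).
Proof.
elim: i => [|i Zac].
  have [u|h hE] := coinduced_injective (j := ker_val)
      (f := dual_map (res_aug Q))
      (@ker_val_inj _ _ _ (dual_map (res_diff Q 0))).
    apply: ker_val_ex; apply: dual_ext => x.
    rewrite -[LHS]/(dual_fun u (res_aug Q (res_diff Q 0 x))) res_aug_diff.
    by rewrite /dual_fun linear0.
  have ainj := dual_map_inj (res_aug_surj Q).
  have [z|h' h'E] := coinduced_injective (j := dual_map (res_aug Q))
      (f := ker_val : {linear dual_cocycles 0 -> _}) ainj.
    have [x /res_aug_exact[y <-]|g gE] := factor_through
        (f := (ker_val z : dual _) : {linear _ -> S^o}) (res_aug_surj Q).
      rewrite -[LHS]/(dual_fun (dual_map (res_diff Q 0) (ker_val z)) y).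
      by rewrite ker_valP.
    by exists (g : dual N); apply: dual_ext => x; apply: gE.
  apply: (acyclic_retract (r := h) (s := h')) PN => z.
  by apply: ker_val_inj; rewrite hE h'E.
have [q qE] := dual_diff_cocycle i; have [qz qu] := dual_diff_ker qE.
apply: (acyclic_coker (j := ker_val) (q := q)) => //.
- exact: ker_val_inj.
- move=> z.
  have [x|g gE] := Qac (f := (ker_val z : dual _) : {linear _ -> S^o}).
    rewrite -[LHS]/(dual_fun (dual_map (res_diff Q i.+1) (ker_val z)) x).
    by rewrite ker_valP.
  exists (g : dual (res_obj Q i)); apply: ker_val_inj; rewrite qE.
  by apply: dual_ext => x; apply: esym (gE x).
- apply: acyclic_dual_basis PR; apply: dual_basis_dual.
  by apply/dual_basisP; split; last exact: res_objP.
Qed.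

(* With Z_i = [dual_cocycles i], a cocycle Q_(i+1) -> N transposes to a map
   N' -> Z_(i+1), which lifts to N' -> Q_i' because Ext^1(N', Z_i) = 0; by
   reflexivity of N the lift is the transpose of a map Q_i -> N. *)
Lemma acyclic_self_of_dual : acyclic Q N.
Proof.
move=> i f fd; have [Nsep Nsurj] := Nrefl.
have [q qE] := dual_diff_cocycle i; have [qz qu] := dual_diff_ker qE.
have [u|f' f'E] := coinduced_injective (j := ker_val)
    (f := dual_map f) (@ker_val_inj _ _ _ (dual_map (res_diff Q i.+1))).
  apply: ker_val_ex; apply: dual_ext => x.
  by rewrite -[LHS]/(dual_fun u (f (res_diff Q i.+1 x))) fd /dual_fun linear0.
have [u|g gE] := acyclic_lift (@ker_val_inj _ _ _ _) qz qu
    (@acyclic_dual_cocycles i) (f := f').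
  have [x|w wE] := Qac (f := (dual_map f u : dual _) : {linear _ -> S^o}).
    by rewrite -[LHS]/(dual_fun u (f (res_diff Q i.+1 x))) fd /dual_fun linear0.
  exists (w : dual (res_obj Q i)); apply: ker_val_inj; rewrite qE f'E.
  by apply: dual_ext => x; apply: esym (wE x).
have [x|x y z xy xz|a x x' y y' xy xy'|h hE] := linear_of_graph
    (r := fun (x : res_obj Q i) (n : N) =>
      forall u, dual_fun (g u) x = dual_fun u n).
- have [n nE] := Nsurj ((eval x : {linear dual (res_obj Q i) -> (S^c)^o}) \o g).
  exists n => u; rewrite -[RHS]/(dual_fun (eval n) u) -nE.
  by [].
- by apply: separated_eq => // u; rewrite -xy -xz.
- move=> u; rewrite /dual_fun !linearP.
  by congr (_ *: _ + _); [exact: xy | exact: xy'].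
exists h => x; apply: separated_eq => // u; rewrite -hE.
rewrite -[LHS]/(dual_fun (dual_map f u) x) -f'E -gE qE.
by [].
Qed.

End DualSelfExtensions.

(** A free cover of [M] embeds [dual M] into the dual of a free module, whose submodules over [L^c]
    are finitely generated. *)
Lemma artin_dual_fg (L : pzRingType) (hL : artin_algebra L) (M : lmodType L) :
  finitely_generated M -> finitely_generated (dual M).
Proof.
move=> /finitely_generatedP[n [p psurj]].
have Fdb : has_dual_basis (free_module L n).
  apply/dual_basisP; split; [exact: free_module_fg|].
  exact: free_module_projective.
have /dual_basisP[dFfg _] := dual_basis_dual Fdb.
have hS := image_submod_closed (dual_map p).
have [x|g gE] := coinduced_injective (f := submod_val (hS := hS))
    (dual_map_inj psurj).
  exact/asboolP/(submod_valP x).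
apply: (@finitely_generated_image _ _ _ g _
  (artin_submod_fg (artin_algebra_converse hL) dFfg hS)).
move=> u; have [|x xE] := submod_val_ex hS (x := dual_map p u).
  by apply/asboolP; exists u.
by exists x; apply: (dual_map_inj psurj); rewrite gE xE.
Qed.

(** * Passing the conjecture between an algebra and its opposite *)

Lemma Gorenstein_projective_conjecture_of_converse (L : pzRingType) :
    artin_algebra L -> Gorenstein_projective_conjecture L^c ->
  Gorenstein_projective_conjecture L.
Proof.
move=> hL gpc M Mfg MGP; split=> [Mproj|MM]; first exact: projective_Ext_all.
have hLc := artin_algebra_converse hL.
have Nfg := artin_dual_fg hL Mfg; have dNfg := artin_dual_fg hLc Nfg.
have [Q Qfg] := resolution_exists hLc Nfg.
have [P _] := resolution_exists (artin_algebra_converse hLc) dNfg.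
have [pM] := minimal_presentation_exists hL Mfg.
have [MR Mrefl Qac] := Gorenstein_projective_reflexive Q pM MGP.
have Nrefl := reflexive_dual Mrefl.
(* [P] resolves the bidual, a module over [(L^c)^c], so the vanishing known for [M] is first carried
   there. *)
have /Ext_allP Pac := Ext_all_bidual_regular Mrefl MR.
have /Ext_allP PN := Ext_all_bidual_self Mrefl MM.
apply: projective_of_dual => //; apply/(gpc _ Nfg).
  exact: reflexive_Gorenstein_projective (Ext_all_acyclic Qac) Nrefl (Pac P).
exact/Ext_all_acyclic/(acyclic_self_of_dual Qfg Qac Nrefl (Pac P) (PN P)).
Qed.

Theorem theorem2p4 (L : pzRingType) (hL : artin_algebra L) :
  Gorenstein_projective_conjecture L <-> Gorenstein_projective_conjecture L^c.
Proof.
split=> gpc; last exact: Gorenstein_projective_conjecture_of_converse.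
apply: Gorenstein_projective_conjecture_of_converse.
  exact: artin_algebra_converse.
(* Applied to [L^c], the lemma asks for the conjecture over [(L^c)^c], which is [L]. *)
by rewrite converseK.
Qed.
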